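(* Let $K$ be a simplicial complex on $m$ vertices, let $J=(j_1,\ldots,j_m)$ be a sequence of positive integers, and let $K(J)$ be the simplicial multiwedge. (a) $K$ is a Golod complex if and only if $K(J)$ is a Golod complex. (b) $K$ is a minimally non-Golod complex if and only if $K(J)$ is minimally non-Golod.
   Context: Simplicial multiwedge: if $K$ has vertex set $\{v_1,\ldots,v_m\}$ and $J=(j_1,\ldots,j_m)$ is a sequence of positive integers, then $K(J)$ is the simplicial complex on the $j_1+\cdots+j_m$ vertices $v_{ik}$ ($1\le i\le m$, $1\le k\le j_i$) whose minimal non-faces are exactly the sets $\{v_{i_11},\ldots,v_{i_1j_{i_1}},\ldots,v_{i_k1},\ldots,v_{i_kj_{i_k}}\}$, where $\{v_{i_1},\ldots,v_{i_k}\}$ is a minimal non-face of $K$. Let $\Bbbk$ be a field or $\mathbb{Z}$. The face ring of a complex $K$ on $m$ vertices is $\Bbbk[K]=\Bbbk[v_1,\ldots,v_m]/\mathcal{I}_K$, where $\mathcal{I}_K$ is generated by the square-free monomials $v_{i_1}\cdots v_{i_k}$ with $\{i_1,\ldots,i_k\}\notin K$. The ring $\Bbbk[K]$ is Golod if the multiplication (of elements of positive degree) and all higher Massey operations in $\mathrm{Tor}_{\Bbbk[v_1,\ldots,v_m]}(\Bbbk[K],\Bbbk)$ are trivial. $K$ is a Golod complex if $\Bbbk[K]$ is Golod for every $\Bbbk$. $K$ is minimally non-Golod if $K$ is not Golod, but for every vertex $v$ the complex $K-v$ (the full subcomplex on all vertices other than $v$) is Golod. *)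

(* Defs.v *)
From HB Require Import structures.
From mathcomp Require Import all_boot all_order all_algebra ring_quotient.
From mathcomp Require Import boolp.
From mathcomp.multinomials Require Import mpoly.

Set Implicit Arguments.
Unset Strict Implicit.
Unset Printing Implicit Defensive.

Import GRing.Theory.
Local Open Scope ring_scope.

(* A simplicial complex with vertex set V: every element of V is a vertex, so
   there are no ghost vertices, and the empty set is a face. *)
Record scomplex (V : finType) := SComplex {
  faces : {set {set V}};
  face_set0 : set0 \in faces;
  face_set1 : forall v : V, [set v] \in faces;
  face_sub : forall S T : {set V}, S \subset T -> T \in faces -> S \in faces
}.

Definition minimal_nonfaces (V : finType) (K : scomplex V) : {set {set V}} :=
  [set M : {set V} | minset [pred S | S \notin faces K] M].

Section FullSubcomplex.
Variables (V : finType) (K : scomplex V) (W : {set V}).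

Definition full_faces : {set {set {v : V | v \in W}}} :=
  [set S : {set {v : V | v \in W}} | val @: S \in faces K].

Fact full_face0 : set0 \in full_faces.
Proof. by rewrite inE imset0 face_set0. Qed.

Fact full_face1 v : [set v] \in full_faces.
Proof. by rewrite inE imset_set1 face_set1. Qed.

Fact full_faceS (S T : {set {v : V | v \in W}}) :
  S \subset T -> T \in full_faces -> S \in full_faces.
Proof. by rewrite !inE => sST; apply: face_sub; apply: imsetS. Qed.

Definition full_subcomplex := SComplex full_face0 full_face1 full_faceS.

End FullSubcomplex.

Definition vertex_deletion (V : finType) (K : scomplex V) (v : V) :=
  full_subcomplex K [set~ v].

Section Multiwedge.
Variables (V : finType) (K : scomplex V) (J : V -> nat).
Hypothesis J_gt0 : forall i : V, (0 < J i)%N.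

(* The vertex v_{ik} is the dependent pair of i and k : 'I_(J i). *)
Local Notation VJ := {i : V & 'I_(J i)}.

Definition blowup (M : {set V}) : {set VJ} := [set x : VJ | tag x \in M].

Definition multiwedge_faces : {set {set VJ}} :=
  [set S : {set VJ} | [forall M in minimal_nonfaces K, ~~ (blowup M \subset S)]].

Lemma blowupS M N : (blowup M \subset blowup N) = (M \subset N).
Proof.
apply/subsetP/subsetP => sMN => [i Mi|x]; last by rewrite !inE => /sMN.
by have := sMN (Tagged (fun i => 'I_(J i)) (Ordinal (J_gt0 i))); rewrite !inE => ->.
Qed.

Fact blowup_set1 M (x : VJ) : blowup M \subset [set x] -> M \subset [set tag x].
Proof.
move=> sM; rewrite -blowupS; apply: (subset_trans sM).
by rewrite sub1set inE set11.
Qed.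

Fact minimal_nonface_notin M : M \in minimal_nonfaces K -> M \notin faces K.
Proof. by rewrite inE => /minsetp. Qed.

Fact multiwedge_face0 : set0 \in multiwedge_faces.
Proof.
rewrite inE; apply/forall_inP => M /minimal_nonface_notin; apply: contra => sM.
suff /eqP-> : M == set0 by apply: face_set0.
rewrite -subset0 -blowupS; apply: (subset_trans sM); exact: sub0set.
Qed.

Fact multiwedge_face1 x : [set x] \in multiwedge_faces.
Proof.
rewrite inE; apply/forall_inP => M /minimal_nonface_notin; apply: contra.
by move=> /blowup_set1 sM; apply: face_sub sM (face_set1 _ _).
Qed.

Fact multiwedge_faceS (S T : {set VJ}) :
  S \subset T -> T \in multiwedge_faces -> S \in multiwedge_faces.
Proof.
rewrite !inE => sST /forall_inP fT; apply/forall_inP => M /fT.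
by apply: contra => /subset_trans; apply.
Qed.

Definition multiwedge :=
  SComplex multiwedge_face0 multiwedge_face1 multiwedge_faceS.

Lemma minimal_nonfaces_multiwedge :
  minimal_nonfaces multiwedge = blowup @: minimal_nonfaces K.
Proof.
have nonface (S : {set VJ}) : reflect (exists2 M, M \in minimal_nonfaces K & blowup M \subset S)
                         (S \notin faces multiwedge).
  rewrite inE negb_forall_in.
  by apply: (iffP exists_inP) => -[M Mm]; rewrite ?negbK => sM; exists M;
     rewrite ?negbK.
apply/setP => S; apply/idP/imsetP.
  rewrite inE => /minsetP[/nonface[M Mm sMS] minS]; exists M => //.
  by rewrite (minS (blowup M)) //; apply/nonface; exists M.
case=> M Mm ->; rewrite inE; apply/minsetP; split.
  by apply/nonface; exists M.
move=> T /nonface[N Nm sNT] sTM.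
have sNM : N \subset M by rewrite -blowupS; apply: subset_trans sTM.
have defN : N = M.
  by move: Mm; rewrite inE => /minsetinf; apply => //; apply: minimal_nonface_notin.
by apply/eqP; rewrite eqEsubset sTM -defN.
Qed.

End Multiwedge.

Section FaceRing.
Variables (k : comNzRingType) (V : finType) (K : scomplex V).

(* The variable of k[V] attached to v is 'X_(enum_rank v). *)
Definition face_monomial (S : {set V}) : {mpoly k[#|V|]} :=
  \prod_(v in S) 'X_(enum_rank v).

(* The ideal generated by the square-free monomials of the non-faces of K. *)
Definition face_ideal : {pred {mpoly k[#|V|]}} :=
  [pred p | `[< exists c : {set V} -> {mpoly k[#|V|]},
                p = \sum_(S | S \notin faces K) c S * face_monomial S >]].

Fact face_ideal_closed : idealr_closed face_ideal.
Proof.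
split.
- apply/asboolP; exists (fun=> 0).
  by rewrite big1 // => S _; rewrite mul0r.
- apply/negP => /asboolP[c /(congr1 (meval (fun=> 0)))].
  rewrite rmorph1 raddf_sum /= big1 => [/eqP|S SnK]; first by rewrite oner_eq0.
  have /set0Pn[v Sv] : S != set0.
    by apply: contraNneq SnK => ->; apply: face_set0.
  by rewrite rmorphM rmorph_prod /= (bigD1 v) //= mevalXU mul0r mulr0.
- move=> a p q /asboolP[c ->] /asboolP[e ->]; apply/asboolP.
  exists (fun S => a * c S + e S).
  rewrite mulr_sumr -big_split; apply: eq_bigr => S _.
  by rewrite mulrDl mulrA.
Qed.

HB.instance Definition _ :=
  isIdealr.Build {mpoly k[#|V|]} face_ideal face_ideal_closed.

Definition face_ring : comNzRingType := {ideal_quot face_ideal}.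

Definition face_ring_var (v : V) : face_ring :=
  \pi_{ideal_quot face_ideal}%qT 'X_(enum_rank v).

End FaceRing.

Section Koszul.
Variables (V : finType) (R : comNzRingType) (x : V -> R).

(* The exterior algebra over R on generators u_v of degree 1, with d u_v = x v.
   The element a is \sum_S a S u_S, where u_S is the product of the u_v, v in S,
   in the order given by enum_rank. *)
Definition koszul : zmodType := {ffun {set V} -> R}.
Implicit Types a b w : koszul.

Definition homogeneous (p : nat) a := forall S : {set V}, #|S| != p -> a S = 0.

(* u_S u_T = (-1)^(inversions S T) u_(S :|: T) when S and T are disjoint. *)
Definition inversions (S T : {set V}) : nat :=
  #|[set vw in setX S T | (enum_rank vw.2 < enum_rank vw.1)%N]|.

Definition kmul a b : koszul :=
  [ffun U : {set V} => \sum_(S : {set V} | S \subset U)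
     (-1) ^+ inversions S (U :\: S) * (a S * b (U :\: S))].

Definition kdiff a : koszul :=
  [ffun S : {set V} => \sum_(v | v \notin S)
     (-1) ^+ inversions [set v] S * (x v * a (v |: S))].

(* The map a |-> (-1)^(deg a) a of the sign conventions for Massey products. *)
Definition kbar a : koszul := [ffun S : {set V} => (-1) ^+ #|S| * a S].

Definition is_cycle a := kdiff a = 0.
Definition is_boundary a := exists b, a = kdiff b.
Definition homologous a b := is_boundary (a - b).

(* A defining system for <[a 0], ..., [a n.-1]>, with deg (a i) = p i: the entries
   M i j, 0 <= i < j <= n, (i, j) != (0, n), satisfy [M i i.+1] = [a i] and
   d (M i j) = \sum_(i < l < j) kbar (M i l) * M l j. *)
Definition defining_system (n : nat) (p : nat -> nat) (a : nat -> koszul)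
    (M : nat -> nat -> koszul) : Prop :=
  (forall i, (i < n)%N -> homologous (M i i.+1) (a i)) /\
  (forall i j, (i < j <= n)%N -> (j - i < n)%N ->
     homogeneous (\sum_(i <= l < j) p l + (j - i).-1)%N (M i j) /\
     kdiff (M i j) = \sum_(i.+1 <= l < j) kmul (kbar (M i l)) (M l j)).

(* A Massey product is a set of homology classes; this says that it contains the
   class of w. *)
Definition massey_product n p (a : nat -> koszul) w : Prop :=
  exists2 M, defining_system n p a M &
    homologous w (\sum_(1 <= l < n) kmul (kbar (M 0%N l)) (M l n)).

Definition trivial_multiplication : Prop :=
  forall p q a b, (0 < p)%N -> (0 < q)%N ->
    homogeneous p a -> homogeneous q b -> is_cycle a -> is_cycle b ->
    is_boundary (kmul a b).

(* Every Massey product of order n >= 3 which is defined contains zero. *)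
Definition trivial_massey : Prop :=
  forall (n : nat) (p : nat -> nat) (a : nat -> koszul), (3 <= n)%N ->
    (forall i, (i < n)%N -> [/\ (0 < p i)%N, homogeneous (p i) (a i) & is_cycle (a i)]) ->
    (exists w, massey_product n p a w) -> massey_product n p a 0.

End Koszul.

(* Tor_{k[V]}(k[K], k), with its multiplication and Massey products, is the
   homology of the Koszul dg algebra of k[K] on the variables: the tensor product
   of k[K] with the Koszul resolution of k over k[V]. Its grading is the
   homological one, and its degree 0 part is k. *)
Definition golod_over (k : comNzRingType) (V : finType) (K : scomplex V) : Prop :=
  trivial_multiplication (face_ring_var k K) /\ trivial_massey (face_ring_var k K).

Definition golod (V : finType) (K : scomplex V) : Prop :=
  (forall k : fieldType, golod_over k K) /\ golod_over int K.

Definition minimally_non_golod (V : finType) (K : scomplex V) : Prop :=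
  ~ golod K /\ forall v : V, golod (vertex_deletion K v).

(* Main.v *)
From HB Require Import structures.
From mathcomp Require Import all_boot all_order all_algebra ssrAC ring_quotient.
From mathcomp Require Import boolp.
From mathcomp.multinomials Require Import mpoly.
Require Import Defs.
From mathcomp Require Import zify ring.

Set Implicit Arguments.
Unset Strict Implicit.
Unset Printing Implicit Defensive.

Import GRing.Theory.

(** Golodness is a property of the Koszul algebra of the face ring as a
differential graded algebra, and it only depends on its quasi-isomorphism type.
Both statements therefore reduce to one comparison of Koszul algebras.

Let f : W -> option V be a partial map with a section s, and let L be the
complex on W whose faces are the sets S such that the v whose whole block
(the fibre of f over v) lies in S form a face of K. A multiwedge is of this
kind, with blocks the copies of each vertex. So is the multiwedge with one vertex
x deleted, relative to K with tag x deleted: the remaining copies of tag x are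
where f is undefined, and they become cone points. The ring k[L] is obtained from
k[K] by the flat base change that replaces the variable of v by the product of
the variables of its block. Hence the two Tor algebras agree, and the comparison
is realised by a morphism [blowup_hom] of Koszul algebras: it sends the generator
u_v to the product of the variables of the block of v other than s v, times
the generator of s v. For (b), deletion of x in the multiwedge is compared with
deletion of tag x in K, and every vertex of K is the tag of some x.

The proof has two halves.

Homotopy invariance. A Massey product is lifted along a morphism phi : B -> A
that induces an isomorphism in homology by lifting its defining system one
diagonal at a time. Such a lift commutes with phi only up to homotopy, and the
homotopies are recorded by the path object of phi, the dga of triples (b, m, c)
where c is a homotopy from phi b to m. The projection (b, m, c) |-> m admits
strict lifts ([path_target_lifting]), so a defining system in A lifts on the
nose to the path object ([lift_solution]) and is then projected to B
([lift_defsys]). This gives the transfer of the vanishing of products and of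
Massey products in both directions ([trivial_products_transfer],
[trivial_higher_transfer]).

The comparison is a quasi-isomorphism. The Koszul algebra of a face ring is
multigraded. In degree c it has the basis of the x^(c - 1_S) u_S, and on the
coefficients of this basis the differential is the simplicial boundary of the
full simplex on the support of c, where the S such that the support of c - 1_S is
not a face are set to zero. The morphism [blowup_hom] is injective, and its image
lies in the degrees that are constant on blocks and zero where f is undefined. In
every other degree left multiplication by a suitable generator is a contraction
([contract_nonconstant]). In a constant degree the vertices outside the image
of s are pushed, one at a time, onto the chosen vertex of their block, which
moves every chain into the image ([push_to_section], [mincl_in_image]). So the
quotient by the image is acyclic, which is the lifting property
[blowup_hom_weak_lifting] required by the first half. *)

(** * Differential graded algebras and Massey products *)

Section Dga.
Local Open Scope ring_scope.

(** [dbar] is the map a |-> (-1)^(deg a) a, and [ddeg n a] says that a is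
homogeneous of degree n. The carrier need not be the sum of its homogeneous
parts. Compatibility with subtraction suffices to build additive structures. *)
Record dga := Dga {
  dga_car :> zmodType;
  dmul : dga_car -> dga_car -> dga_car;
  ddiff : dga_car -> dga_car;
  dbar : dga_car -> dga_car;
  ddeg : nat -> dga_car -> Prop;
  dmulBl : forall b a c, dmul (a - c) b = dmul a b - dmul c b;
  dmulBr : forall a, {morph dmul a : b c / b - c};
  dmulA : associative dmul;
  ddiffB : {morph ddiff : a b / a - b};
  dbarB : {morph dbar : a b / a - b};
  dbarK : involutive dbar;
  dbarM : {morph dbar : a b / dmul a b};
  ddiffK : forall a, ddiff (ddiff a) = 0;
  ddiff_bar : forall a, ddiff (dbar a) = - dbar (ddiff a);
  ddiffM : forall a b,
    ddiff (dmul a b) = dmul (ddiff a) b + dmul (dbar a) (ddiff b);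
  ddeg0 : forall n, ddeg n 0;
  ddegB : forall n a b, ddeg n a -> ddeg n b -> ddeg n (a - b);
  ddeg_bar : forall n a, ddeg n a -> ddeg n (dbar a);
  ddeg_diff : forall n a, ddeg n.+1 a -> ddeg n (ddiff a);
  ddegM : forall n m a b, ddeg n a -> ddeg m b -> ddeg (n + m) (dmul a b)
}.

HB.instance Definition _ (A : dga) :=
  GRing.isZmodMorphism.Build A A (@ddiff A) (@ddiffB A).
HB.instance Definition _ (A : dga) :=
  GRing.isZmodMorphism.Build A A (@dbar A) (@dbarB A).
HB.instance Definition _ (A : dga) (a : A) :=
  GRing.isZmodMorphism.Build A A (@dmul A a) (@dmulBr A a).

Section Basics.
Variable A : dga.
Implicit Types (a b c : A) (M : nat -> nat -> A).

Lemma ddegN n a : ddeg n a -> ddeg n (- a).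
Proof. by move=> da; rewrite -sub0r; apply: ddegB => //; apply: ddeg0. Qed.

Lemma ddegD n a b : ddeg n a -> ddeg n b -> ddeg n (a + b).
Proof. by move=> da db; rewrite -[b]opprK; apply: ddegB => //; apply: ddegN. Qed.

Lemma ddeg_sum n (I : eqType) (r : seq I) (F : I -> A) :
  (forall i, i \in r -> ddeg n (F i)) -> ddeg n (\sum_(i <- r) F i).
Proof.
move=> dF; rewrite big_seq; apply: (big_ind (@ddeg A n)) => //.
  exact: ddeg0.
by move=> a b; apply: ddegD.
Qed.

Lemma dmul0l b : dmul 0 b = 0.
Proof. by have := dmulBl b 0 0; rewrite subrr subrr. Qed.

Lemma dmulNl a b : dmul (- a) b = - dmul a b.
Proof. by rewrite -[- a]sub0r dmulBl dmul0l sub0r. Qed.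

Lemma dmulDl a b c : dmul (a + b) c = dmul a c + dmul b c.
Proof. by rewrite -[in LHS](opprK b) dmulBl dmulNl opprK. Qed.

Lemma dmul_suml I (r : seq I) (F : I -> A) b :
  dmul (\sum_(i <- r) F i) b = \sum_(i <- r) dmul (F i) b.
Proof. by apply: (big_morph (@dmul A ^~ b)) => [? ?|] /=; rewrite ?dmulDl ?dmul0l. Qed.

Lemma dmul_sumr I (r : seq I) (F : I -> A) a :
  dmul a (\sum_(i <- r) F i) = \sum_(i <- r) dmul a (F i).
Proof. exact: (raddf_sum (@dmul A a)). Qed.

Definition dboundary a := exists b, a = ddiff b.
Definition dhomologous a b := dboundary (a - b).

Lemma dhomologous_trans a b c :
  dhomologous a b -> dhomologous b c -> dhomologous a c.
Proof.
by move=> [x ex] [y ey]; exists (x + y); rewrite raddfD /= -ex -ey addrA subrK.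
Qed.

Lemma dhomologous_sym a b : dhomologous a b -> dhomologous b a.
Proof. by move=> [x ex]; exists (- x); rewrite raddfN /= -ex opprB. Qed.

Definition twisted_sum M i j := \sum_(i.+1 <= l < j) dmul (dbar (M i l)) (M l j).

Definition massey_degree (p : nat -> nat) i j :=
  (\sum_(i <= l < j) p l + (j - i).-1)%N.

(** The part of the definition of a defining system that does not mention the
classes on the first diagonal. Morphisms transport it strictly. *)
Definition solves n p M := forall i j, (i < j <= n)%N -> (j - i < n)%N ->
  ddeg (massey_degree p i j) (M i j) /\ ddiff (M i j) = twisted_sum M i j.

Definition defsys n p (a : nat -> A) M :=
  (forall i, (i < n)%N -> dhomologous (M i i.+1) (a i)) /\ solves n p M.

Definition dmassey n p (a : nat -> A) w :=
  exists2 M, defsys n p a M & dhomologous w (twisted_sum M 0 n).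

Definition trivial_products := forall p q a b, (0 < p)%N -> (0 < q)%N ->
  ddeg p a -> ddeg q b -> ddiff a = 0 -> ddiff b = 0 -> dboundary (dmul a b).

Definition trivial_higher := forall n p (a : nat -> A), (3 <= n)%N ->
  (forall i, (i < n)%N -> [/\ (0 < p i)%N, ddeg (p i) (a i) & ddiff (a i) = 0]) ->
  (exists w, dmassey n p a w) -> dmassey n p a 0.

Lemma big_triangle (F : nat -> nat -> A) i j :
  \sum_(i.+1 <= l < j) \sum_(i.+1 <= m < l) F m l
   = \sum_(i.+1 <= m < j) \sum_(m.+1 <= l < j) F m l.
Proof.
have tri m l : (i.+1 <= m)%N -> (m < l < j)%N -> (i.+1 <= l < j)%N by lia.
transitivity (\sum_(i.+1 <= l < j) \sum_(i.+1 <= m < j | (m < l)%N) F m l).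
  apply: eq_big_nat => l /andP[_ lj].
  by rewrite (big_nat_widen _ _ _ _ _ (ltnW lj)).
rewrite (exchange_big_dep_nat xpredT) //=; apply: eq_big_nat => m /andP[im _].
by rewrite [RHS](big_nat_widenl _ i.+1) // ltnW.
Qed.

(** Expanding the differential by the equations of the shorter entries gives, for
each pair of cut points i < m < l < j, the same triple product twice, with
opposite signs. *)
Lemma twisted_sum_cycle M i j :
  (forall l, (i < l < j)%N -> ddiff (M i l) = twisted_sum M i l /\
                             ddiff (M l j) = twisted_sum M l j) ->
  ddiff (twisted_sum M i j) = 0.
Proof.
move=> dM; rewrite /twisted_sum raddf_sum /=.
rewrite (eq_big_nat _ _ (F2 := fun l =>
  \sum_(l.+1 <= m < j) dmul (M i l) (dmul (dbar (M l m)) (M m j))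
  - \sum_(i.+1 <= m < l) dmul (M i m) (dmul (dbar (M m l)) (M l j)))).
  by rewrite sumrB big_triangle subrr.
move=> l ilj; have [dil dlj] := dM l ilj.
rewrite ddiffM ddiff_bar dbarK dil dlj dmulNl addrC /twisted_sum.
rewrite dmul_sumr (raddf_sum (@dbar A)) /= dmul_suml; congr (_ - _).
by apply: eq_bigr => m _; rewrite dbarM dbarK dmulA.
Qed.

Lemma massey_degree_split p i l j : (i < l < j)%N ->
  (massey_degree p i l + massey_degree p l j).+1 = massey_degree p i j.
Proof.
move=> /andP[il lj]; rewrite /massey_degree.
rewrite (big_cat_nat (ltnW il) (ltnW lj)) /=; lia.
Qed.

Lemma ddeg_twisted_sum n p M i j : (i < j)%N ->
  (forall l, (i < l < j)%N -> ddeg (massey_degree p i l) (M i l) /\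
                             ddeg (massey_degree p l j) (M l j)) ->
  n.+1 = massey_degree p i j -> ddeg n (twisted_sum M i j).
Proof.
move=> ij dM En; apply: ddeg_sum => l; rewrite mem_index_iota => ilj.
have [dil dlj] := dM l ilj.
have -> : n = (massey_degree p i l + massey_degree p l j)%N.
  by apply: succn_inj; rewrite massey_degree_split.
by apply: ddegM => //; apply: ddeg_bar.
Qed.

End Basics.

Record dga_hom (B A : dga) := DgaHom {
  dga_fun :> B -> A;
  dga_funB : {morph dga_fun : a b / a - b};
  dga_funM : {morph dga_fun : a b / dmul a b};
  dga_fun_diff : {morph dga_fun : a / ddiff a};
  dga_fun_bar : {morph dga_fun : a / dbar a};
  dga_fun_deg : forall n a, ddeg n a -> ddeg n (dga_fun a)
}.

HB.instance Definition _ (B A : dga) (f : dga_hom B A) :=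
  GRing.isZmodMorphism.Build B A f (@dga_funB B A f).

Lemma dga_fun_sum (B A : dga) (f : dga_hom B A) I (r : seq I) (P : pred I) (F : I -> B) :
  f (\sum_(i <- r | P i) F i) = \sum_(i <- r | P i) f (F i).
Proof. exact: raddf_sum. Qed.

Lemma hom_twisted_sum (B A : dga) (f : dga_hom B A) M i j :
  f (twisted_sum M i j) = twisted_sum (fun i j => f (M i j)) i j.
Proof.
rewrite /twisted_sum raddf_sum; apply: eq_bigr => l _ /=.
by rewrite dga_funM dga_fun_bar.
Qed.

Lemma hom_solves (B A : dga) (f : dga_hom B A) n p M :
  solves n p M -> solves n p (fun i j => f (M i j)).
Proof.
move=> sM i j ijn jin; have [dM eM] := sM i j ijn jin; split.
  exact: dga_fun_deg.
by rewrite -dga_fun_diff eM hom_twisted_sum.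
Qed.

(** This is what acyclicity of the kernel of a surjective morphism gives: a
relative cycle (z, a) bounds on the nose. *)
Definition strict_lifting (P A : dga) (q : dga_hom P A) :=
  forall n z a, ddeg n z -> ddiff z = 0 -> ddeg n.+1 a -> q z = ddiff a ->
  exists y, [/\ ddeg n.+1 y, q y = a & ddiff y = z].

(** Vanishing of the homology of the mapping cone of f, in elementwise form. It
contains injectivity in homology (take for a any chain with boundary f b) and
surjectivity in positive degrees (take b = 0). *)
Definition weak_lifting (B A : dga) (f : dga_hom B A) :=
  forall n b a, ddeg n b -> ddiff b = 0 -> ddeg n.+1 a -> f b = ddiff a ->
  exists b' c, [/\ ddeg n.+1 b', ddeg n.+2 c, ddiff b' = b & f b' = a + ddiff c].

(** Induction on j - i. The right hand side of the equation for N i j is a cycle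
that lies over the boundary of M i j, so strict lifting gives an N i j over M i j
with the required boundary. On the first diagonal the right hand side is zero,
and positivity of the degree p i makes the lifting property applicable. *)
Lemma lift_solution (P A : dga) (q : dga_hom P A) n p M :
  strict_lifting q -> (forall i, (i < n)%N -> (0 < p i)%N) -> solves n p M ->
  exists2 N, solves n p N &
    forall i j, (i < j <= n)%N -> (j - i < n)%N -> q (N i j) = M i j.
Proof.
move=> liftq p_gt0 sM.
suff [N sN] : exists N, forall i j, (i < j <= n)%N -> (j - i < n)%N ->
    [/\ ddeg (massey_degree p i j) (N i j), ddiff (N i j) = twisted_sum N i j
      & q (N i j) = M i j].
  exists N => i j ijn jin; have [] := sN i j ijn jin; by [].
suff step d : exists N, forall i j, (i < j <= n)%N -> (j - i < n)%N ->
    (j - i <= d)%N ->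
    [/\ ddeg (massey_degree p i j) (N i j), ddiff (N i j) = twisted_sum N i j
      & q (N i j) = M i j].
  by have [N sN] := step n; exists N => i j ijn jin; apply: sN => //; lia.
elim: d => [|d [N sN]]; first by exists (fun _ _ => 0) => i j; lia.
have new i : exists y, (i + d.+1 <= n)%N -> (d.+1 < n)%N ->
    [/\ ddeg (massey_degree p i (i + d.+1)) y,
        ddiff y = twisted_sum N i (i + d.+1) & q y = M i (i + d.+1)%N].
  have [idn|] := leqP (i + d.+1) n; last by exists 0; lia.
  have [dn|] := leqP d.+2 n; last by exists 0; lia.
  have [||dMi eMi] := sM i (i + d.+1)%N; [lia|lia|].
  have N1 l : (i < l < i + d.+1)%N -> [/\ ddeg (massey_degree p i l) (N i l),
      ddiff (N i l) = twisted_sum N i l & q (N i l) = M i l].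
    by move=> ?; apply: sN; lia.
  have N2 l : (i < l < i + d.+1)%N ->
      [/\ ddeg (massey_degree p l (i + d.+1)) (N l (i + d.+1)%N),
      ddiff (N l (i + d.+1)%N) = twisted_sum N l (i + d.+1)
      & q (N l (i + d.+1)%N) = M l (i + d.+1)%N].
    by move=> ?; apply: sN; lia.
  have pi_gt0 : (0 < p i)%N by apply: p_gt0; lia.
  (* the lifting property speaks of degrees of the form n.+1 *)
  have Eg : (massey_degree p i (i + d.+1)).-1.+1 = massey_degree p i (i + d.+1).
    by rewrite prednK // /massey_degree big_ltn; lia.
  have [y []] : exists y, [/\ ddeg (massey_degree p i (i + d.+1)).-1.+1 y,
      q y = M i (i + d.+1)%N & ddiff y = twisted_sum N i (i + d.+1)]; last first.
    by rewrite Eg => dy qy ey; exists y.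
  apply: liftq.
  - apply: ddeg_twisted_sum Eg => [|l ilj]; first lia.
    by split; [case: (N1 l ilj)|case: (N2 l ilj)].
  - apply: twisted_sum_cycle => l ilj.
    by split; [case: (N1 l ilj)|case: (N2 l ilj)].
  - by rewrite Eg.
  - rewrite eMi hom_twisted_sum; apply: eq_big_nat => l ilj.
    by have [_ _ ->] := N1 l ilj; have [_ _ ->] := N2 l ilj.
have [y ys] := choice new.
pose N' i j := if (j - i <= d)%N then N i j else y i.
have oldN' i j : (j - i <= d)%N -> N' i j = N i j by rewrite /N' => ->.
have sumN' i j : (j - i <= d.+1)%N -> twisted_sum N' i j = twisted_sum N i j.
  by move=> jid; apply: eq_big_nat => l ilj; rewrite !oldN' //; lia.
exists N' => i j ijn jin jid; rewrite sumN' //.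
have [jid'|jid'] := leqP (j - i) d; first by rewrite oldN' //; apply: sN.
rewrite /N' leqNgt jid' /=; have Ej : j = (i + d.+1)%N by lia.
by rewrite Ej; apply: ys; lia.
Qed.

End Dga.

(** * Path objects *)

Section Path.
Local Open Scope ring_scope.
Variables (B A : dga) (f : dga_hom B A).

(** The third component of (b, m, c) has its degree shifted by one and is a
homotopy from f b to m: (b, m, c) is a cycle exactly when b and m are cycles and
m - f b is the boundary of c. The products are those that make this a dga: the
homotopy of a product is c m' + bar (f b) c'. *)
Definition path_car : zmodType := (B * A * A)%type.
Implicit Types y z : path_car.

Definition path_mul y z : path_car :=
  (dmul y.1.1 z.1.1, dmul y.1.2 z.1.2, dmul y.2 z.1.2 + dmul (dbar (f y.1.1)) z.2).
Definition path_diff y : path_car :=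
  (ddiff y.1.1, ddiff y.1.2, y.1.2 - f y.1.1 - ddiff y.2).
Definition path_bar y : path_car := (dbar y.1.1, dbar y.1.2, - dbar y.2).
Definition path_deg n y := [/\ ddeg n y.1.1, ddeg n y.1.2 & ddeg n.+1 y.2].

Lemma path_ext y z : y.1.1 = z.1.1 -> y.1.2 = z.1.2 -> y.2 = z.2 -> y = z.
Proof. by case: y => [[? ?] ?]; case: z => [[? ?] ?] /= -> -> ->. Qed.

Let addE (y z : path_car) : ((y + z).1.1 = y.1.1 + z.1.1) *
  ((y + z).1.2 = y.1.2 + z.1.2) * ((y + z).2 = y.2 + z.2).
Proof. by []. Qed.

Let oppE (y : path_car) : ((- y).1.1 = - y.1.1) *
  ((- y).1.2 = - y.1.2) * ((- y).2 = - y.2).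
Proof. by []. Qed.

Let subrACA (G : zmodType) (a b c d : G) : (a - b) - (c - d) = (a - c) - (b - d).
Proof. by rewrite opprD addrACA -opprD. Qed.

Fact path_mulBl z a c : path_mul (a - c) z = path_mul a z - path_mul c z.
Proof.
 apply: path_ext; rewrite /= ?addE ?oppE ?dmulBl //=.
by rewrite dga_funB dbarB !dmulBl opprD addrACA.
Qed.

Fact path_mulBr y : {morph path_mul y : a c / a - c}.
Proof.
move=> a c; apply: path_ext; rewrite /= ?addE ?oppE ?dmulBr //=.
by rewrite opprD addrACA.
Qed.

Fact path_mulA : associative path_mul.
Proof.
move=> a b c; apply: path_ext; rewrite /= ?dmulA //.
by rewrite (raddfD (@dmul A _)) !dmulDl /= !dmulA dga_funM dbarM addrA.
Qed.

Fact path_diffB : {morph path_diff : a b / a - b}.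
Proof.
move=> a b; apply: path_ext; rewrite /= ?ddiffB ?dga_funB //=.
by rewrite [RHS]subrACA; congr (_ - _); apply: subrACA.
Qed.

Fact path_barB : {morph path_bar : a b / a - b}.
Proof. by move=> a b; apply: path_ext; rewrite /= ?dbarB // opprD. Qed.

Fact path_barK : involutive path_bar.
Proof. by move=> a; apply: path_ext; rewrite /= ?raddfN ?opprK /= dbarK. Qed.

Fact path_barM : {morph path_bar : a b / path_mul a b}.
Proof.
move=> a b; apply: path_ext; rewrite /= ?dbarM //.
rewrite raddfD /= opprD !dbarM dbarK dmulNl; congr (_ + _).
by rewrite raddfN /= dga_fun_bar dbarK.
Qed.

Fact path_diffK a : path_diff (path_diff a) = 0.
Proof.
apply: path_ext; rewrite /= ?ddiffK //.
by rewrite !ddiffB ddiffK dga_fun_diff subr0 subrr.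
Qed.

Fact path_diff_bar a : path_diff (path_bar a) = - path_bar (path_diff a).
Proof.
apply: path_ext; rewrite /= ?ddiff_bar // opprK !dbarB dga_fun_bar.
by rewrite raddfN /= ddiff_bar opprK.
Qed.

Fact path_diffM a b :
  path_diff (path_mul a b) =
  path_mul (path_diff a) b + path_mul (path_bar a) (path_diff b).
Proof.
apply: path_ext; rewrite /= ?ddiffM //=.
rewrite raddfD /= !ddiffM dga_funM ddiff_bar dga_fun_diff dga_fun_bar !dbarK.
rewrite !dmulBl !dmulBr !dmulNl.
set x1 := dmul a.1.2 _; set x2 := dmul (f _) (f _); set x3 := dmul (ddiff _) _.
set x4 := dmul (dbar a.2) _; set x5 := dmul (dbar (ddiff _)) _.
set x6 := dmul (f _) (ddiff _); set x7 := dmul (f a.1.1) b.1.2.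
rewrite !opprD !opprK !addrA.
by rewrite [RHS](ACl ((6*2)*1*7*3*5*4*8)) /= subrr add0r.
Qed.

Fact path_deg0 n : path_deg n 0.
Proof. by split; apply: ddeg0. Qed.

Fact path_degB n a b : path_deg n a -> path_deg n b -> path_deg n (a - b).
Proof. by move=> [? ? ?] [? ? ?]; split; apply: ddegB. Qed.

Fact path_deg_bar n a : path_deg n a -> path_deg n (path_bar a).
Proof. by move=> [? ? ?]; split; rewrite /=; try apply: ddegN; apply: ddeg_bar. Qed.

Fact path_deg_diff n a : path_deg n.+1 a -> path_deg n (path_diff a).
Proof.
move=> [? ? ?]; split; rewrite /=; try exact: ddeg_diff.
by apply: ddegB (ddeg_diff _) => //; apply: ddegB => //; apply: dga_fun_deg.
Qed.

Fact path_degM n m a b :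
  path_deg n a -> path_deg m b -> path_deg (n + m) (path_mul a b).
Proof.
move=> [? ? ?] [? ? ?]; split; rewrite /=; try exact: ddegM.
apply: ddegD; first by rewrite -addSn; apply: ddegM.
by rewrite -addnS; apply: ddegM => //; apply/ddeg_bar/dga_fun_deg.
Qed.

Definition path_dga := Dga path_mulBl path_mulBr path_mulA path_diffB path_barB
  path_barK path_barM path_diffK path_diff_bar path_diffM path_deg0 path_degB
  path_deg_bar path_deg_diff path_degM.

Definition path_source : dga_hom path_dga B.
Proof.
refine (@DgaHom path_dga B (fun y : path_car => y.1.1) _ _ _ _ _) => //.
by move=> n a [].
Defined.

Definition path_target : dga_hom path_dga A.
Proof.
refine (@DgaHom path_dga A (fun y : path_car => y.1.2) _ _ _ _ _) => //.
by move=> n a [].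
Defined.

(** For a cycle z = (b, m, c) over m = d a, the chain a - c has boundary f b. The
weak lifting property applied to b and a - c gives the missing components. *)
Lemma path_target_lifting : weak_lifting f -> strict_lifting path_target.
Proof.
move=> liftf n [[b m] c] a [/= db dm dc] [eb em ec] da ma.
have fb : f b = ddiff (a - c).
  by rewrite ddiffB -ma; move/subr0_eq: ec => <-; rewrite subKr.
have [b' [e [db' de eb' fb']]] := liftf _ _ _ db eb (ddegB da dc) fb.
exists (b', a, - e); split => //; first by split => //; apply: ddegN.
apply: path_ext => //=; rewrite fb' raddfN /= opprK !opprD opprK.
by rewrite !addrA subrr add0r subrK.
Qed.

End Path.

(** * Invariance of triviality under quasi-isomorphism *)

Section Transfer.
Local Open Scope ring_scope.
Variables (B A : dga) (f : dga_hom B A).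

Hypothesis graded_boundary :
  forall n (a : A), ddeg n a -> dboundary a -> exists2 c, ddeg n.+1 c & a = ddiff c.
Hypothesis liftf : weak_lifting f.

(** Boundaries are not assumed homogeneous in the definition of a Massey product,
while lifting is graded; [graded_boundary] bridges the two. *)
Lemma boundary_reflect n (b : B) :
  ddeg n b -> ddiff b = 0 -> dboundary (f b) -> dboundary b.
Proof.
move=> db eb /(graded_boundary (dga_fun_deg f db))[a da fba].
by have [b' [c [_ _ <- _]]] := liftf db eb da fba; exists b'.
Qed.

(** Lifting over b = 0; this is where positive degree is used. *)
Lemma cycle_lift n (a : A) : (0 < n)%N -> ddeg n a -> ddiff a = 0 ->
  exists b, [/\ ddeg n b, ddiff b = 0 & dhomologous (f b) a].
Proof.
case: n => // n _ da ea.
have f0 : f 0 = ddiff a by rewrite raddf0.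
have [b [c [db _ eb fb]]] := liftf (ddeg0 _ _) (raddf0 _) da f0.
by exists b; split => //; exists c; rewrite fb addrAC subrr add0r.
Qed.

Lemma boundaryM_homologous (a a' b b' : A) :
  ddiff a = 0 -> ddiff b = 0 -> ddiff a' = 0 ->
  dhomologous a' a -> dhomologous b' b -> dboundary (dmul a' b') ->
  dboundary (dmul a b).
Proof.
move=> ea eb ea' [x ex] [y ey] [z ez].
exists (z - dmul x b - dmul (dbar a') y).
rewrite !ddiffB -ez !ddiffM -ex -ey eb ddiff_bar ea' !raddf0 !dbarK.
rewrite dmul0l addr0 add0r dmulBl dmulBr.
by rewrite !opprB !addrA [RHS](ACl ((1*5)*(4*3)*2)) /= !subrr !add0r.
Qed.

(** The system is lifted to the path object of f and projected to B. On the first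
diagonal a lifted entry is a triple (b', m, c) which shows that f b' is homologous
to m, hence to f (b i), so that b' and b i are homologous because f reflects
boundaries. A bounding chain of the last twisted sum lifts strictly too. *)
Lemma lift_defsys n p (b : nat -> B) M :
  (2 <= n)%N ->
  (forall i, (i < n)%N -> [/\ (0 < p i)%N, ddeg (p i) (b i) & ddiff (b i) = 0]) ->
  defsys n p (fun i => f (b i)) M ->
  exists2 N, defsys n p b N &
    dboundary (twisted_sum M 0 n) -> dboundary (twisted_sum N 0 n).
Proof.
move=> n_ge2 bP [M1 sM].
have p_gt0 i : (i < n)%N -> (0 < p i)%N by case/bP.
have liftq := path_target_lifting liftf.
have [N sN qN] := lift_solution liftq p_gt0 sM.
pose N' i j := path_source f (N i j).
have sN' : solves n p N' by apply: hom_solves.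
have degN i : (i < n)%N -> massey_degree p i i.+1 = p i.
  by move=> _; rewrite /massey_degree big_nat1 subSnn addn0.
exists N'.
- split=> // i ltin; have [_ dbi ebi] := bP i ltin.
  have [] := sN' i i.+1; rewrite ?ltnSn ?subSnn //.
  rewrite degN // => dNi; rewrite /twisted_sum big_geq // => eNi.
  apply: (@boundary_reflect (p i)); first exact: ddegB.
    by rewrite ddiffB eNi ebi subr0.
  rewrite dga_funB; apply: (@dhomologous_trans _ _ (M i i.+1)); last exact: M1.
  have [] := sN i i.+1; rewrite ?ltnSn ?subSnn // => _.
  rewrite /twisted_sum big_geq // => -[_ _ /subr0_eq].
  rewrite -(qN i i.+1) ?ltnSn ?subSnn //= => eq2.
  by apply: dhomologous_sym; exists (N i i.+1).2.
- have Nin l : (0 < l < n)%N -> (0 < l <= n)%N && (l - 0 < n)%N by lia.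
  have Nin' l : (0 < l < n)%N -> (l < n <= n)%N && (n - l < n)%N by lia.
  pose g := (massey_degree p 0 n).-1.
  have Eg : g.+1 = massey_degree p 0 n.
    by rewrite prednK // /massey_degree big_ltn; have := p_gt0 0%N; lia.
  have dN : ddeg g (twisted_sum N 0 n).
    apply: ddeg_twisted_sum Eg => [|l l0n]; first lia.
    split; [have /andP[u v] := Nin l l0n|have /andP[u v] := Nin' l l0n];
      by case: (sN _ _ u v).
  have eN : ddiff (twisted_sum N 0 n) = 0.
    apply: twisted_sum_cycle => l l0n.
    split; [have /andP[u v] := Nin l l0n|have /andP[u v] := Nin' l l0n];
      by case: (sN _ _ u v).
  have pN : path_target f (twisted_sum N 0 n) = twisted_sum M 0 n.
    rewrite hom_twisted_sum; apply: eq_big_nat => l l0n.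
    have /andP[u v] := Nin l l0n; rewrite (qN _ _ u v).
    by have /andP[u' v'] := Nin' l l0n; rewrite (qN _ _ u' v').
  move=> bM; have dM : ddeg g (twisted_sum M 0 n) by rewrite -pN; apply: dga_fun_deg.
  have [a da ea] := graded_boundary dM bM.
  have [y [_ _ ey]] := liftq _ _ _ dN eN da (etrans pN ea).
  exists (path_source f y).
  by rewrite -dga_fun_diff ey hom_twisted_sum.
Qed.

Theorem trivial_products_transfer : trivial_products B <-> trivial_products A.
Proof.
split=> [tB p q a b p0 q0 da db ea eb | tA p q a b p0 q0 da db ea eb].
  have [a' [da' ea' ha]] := cycle_lift p0 da ea.
  have [b' [db' eb' hb]] := cycle_lift q0 db eb.
  have [c ec] := tB _ _ _ _ p0 q0 da' db' ea' eb'.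
  apply: boundaryM_homologous ha hb _ => //; first by rewrite -dga_fun_diff ea' raddf0.
  by exists (f c); rewrite -dga_funM ec dga_fun_diff.
apply: boundary_reflect (ddegM da db) _ _.
  by rewrite ddiffM ea eb raddf0 dmul0l addr0.
rewrite dga_funM; apply: (tA p q) => //; try exact: dga_fun_deg.
  by rewrite -dga_fun_diff ea raddf0.
by rewrite -dga_fun_diff eb raddf0.
Qed.

Lemma dmassey0 (C : dga) n p (a : nat -> C) :
  dmassey n p a 0 <-> exists2 M, defsys n p a M & dboundary (twisted_sum M 0 n).
Proof.
split=> -[M sM [x ex]]; exists M => //; exists (- x); rewrite raddfN /= -ex.
  by rewrite sub0r opprK.
by rewrite sub0r.
Qed.

Lemma defsys_homologous (C : dga) n p (a b : nat -> C) M :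
  (forall i, (i < n)%N -> dhomologous (a i) (b i)) ->
  defsys n p a M -> defsys n p b M.
Proof.
move=> ab [M1 sM]; split=> // i ltin.
by apply: dhomologous_trans (M1 i ltin) (ab i ltin).
Qed.

Lemma hom_defsys n p (b : nat -> B) N :
  defsys n p b N -> defsys n p (fun i => f (b i)) (fun i j => f (N i j)).
Proof.
move=> [N1 sN]; split; last exact: hom_solves.
by move=> i /N1[x ex]; exists (f x); rewrite -dga_funB ex dga_fun_diff.
Qed.

(** From B to A, a defining system in A is lifted to B only to know that the
Massey product in B is defined; the trivial system found there is mapped back to
A. From A to B, it is the trivial system found in A that has to be lifted. *)
Theorem trivial_higher_transfer : trivial_higher B <-> trivial_higher A.
Proof.
split=> [tB n p a n3 aP [w [M sM _]] | tA n p b n3 bP [w [N sN _]]].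
  have lifta i : exists b, (i < n)%N ->
      [/\ ddeg (p i) b, ddiff b = 0 & dhomologous (f b) (a i)].
    have [ltin|] := ltnP i n; last by exists 0.
    have [p0 da ea] := aP i ltin.
    by have [b bP] := cycle_lift p0 da ea; exists b.
  have [b bP] := choice lifta.
  have bP' i : (i < n)%N -> [/\ (0 < p i)%N, ddeg (p i) (b i) & ddiff (b i) = 0].
    by move=> ltin; have [? _ _] := aP i ltin; have [] := bP i ltin.
  have sMb : defsys n p (fun i => f (b i)) M.
    by apply: defsys_homologous sM => i /bP[_ _ ?]; apply: dhomologous_sym.
  have [N sN _] := lift_defsys (ltnW n3) bP' sMb.
  have /dmassey0[N' sN' [x ex]] : dmassey n p b 0.
    apply: tB => //; exists (twisted_sum N 0 n); exists N => //.
    by exists 0; rewrite subrr raddf0.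
  apply/dmassey0; exists (fun i j => f (N' i j)).
    by apply: defsys_homologous (hom_defsys sN') => i /bP[].
  by exists (f x); rewrite -hom_twisted_sum ex dga_fun_diff.
have fbP i : (i < n)%N ->
    [/\ (0 < p i)%N, ddeg (p i) (f (b i)) & ddiff (f (b i)) = 0].
  move=> /bP[? ? eb]; split=> //; first exact: dga_fun_deg.
  by rewrite -dga_fun_diff eb raddf0.
have /dmassey0[M sM bM] : dmassey n p (fun i => f (b i)) 0.
  apply: tA => //; exists (twisted_sum (fun i j => f (N i j)) 0 n).
  by exists (fun i j => f (N i j)); [apply: hom_defsys|exists 0; rewrite subrr raddf0].
have [N' sN' bN'] := lift_defsys (ltnW n3) bP sM.
by apply/dmassey0; exists N' => //; apply: bN'.
Qed.

End Transfer.

Lemma big_setU_disjoint (G : Type) (idx : G) (op : Monoid.com_law idx) (I : finType)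
    (S T : {set I}) (F : I -> G) : [disjoint S & T] ->
  \big[op/idx]_(i in S :|: T) F i
   = op (\big[op/idx]_(i in S) F i) (\big[op/idx]_(i in T) F i).
Proof.
move=> dST; rewrite -bigU //; apply: eq_bigl => i.
by rewrite !inE.
Qed.

(** * Inversion counts *)

Section Signs.
Variable V : finType.
Implicit Types (S T U : {set V}) (v w : V).

Lemma inversionsE S T :
  inversions S T = \sum_(v in S) \sum_(w in T) (enum_rank w < enum_rank v).
Proof.
rewrite /inversions -sum1_card pair_big_dep /= big_mkcond [RHS]big_mkcond.
apply: eq_bigr => -[v w] _ /=; rewrite !inE /=.
by case: (v \in S) => //=; case: (w \in T) => //=; case: ltnP.
Qed.

Lemma inversionsUl S T U : [disjoint S & T] ->
  inversions (S :|: T) U = inversions S U + inversions T U.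
Proof. by move=> dST; rewrite !inversionsE big_setU_disjoint. Qed.

Lemma inversionsUr S T U : [disjoint T & U] ->
  inversions S (T :|: U) = inversions S T + inversions S U.
Proof.
move=> dTU; rewrite !inversionsE -big_split.
by apply: eq_bigr => v _; rewrite big_setU_disjoint.
Qed.

(** Each element of S is either smaller or larger than v, so moving u_v past u_S
costs #|S| signs. *)
Lemma inversions1_swap v S : v \notin S ->
  inversions [set v] S + inversions S [set v] = #|S|.
Proof.
move=> vS; rewrite !inversionsE big_set1 -big_split -[RHS]sum1_card /=.
apply: eq_bigr => w wS; rewrite big_set1.
have : enum_rank w != enum_rank v.
  by rewrite (inj_eq enum_rank_inj); apply: contraNneq vS => <-.
by rewrite -val_eqE /=; case: ltngtP.
Qed.

End Signs.

(** * Koszul algebras as differential graded algebras *)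

Section KoszulBasis.
Local Open Scope ring_scope.
Variables (V : finType) (R : comNzRingType) (x : V -> R).
Implicit Types (S T U : {set V}) (v w : V) (a b c : koszul V R).

Definition sg S T : R := (-1) ^+ inversions S T.

Lemma sgK S T t : sg S T * (sg S T * t) = t.
Proof. by rewrite mulrA -expr2 sqrr_sign mul1r. Qed.

Lemma sgUl S T U : [disjoint S & T] -> sg (S :|: T) U = sg S U * sg T U.
Proof. by move=> dST; rewrite /sg inversionsUl // exprD. Qed.

Lemma sgUr S T U : [disjoint T & U] -> sg S (T :|: U) = sg S T * sg S U.
Proof. by move=> dST; rewrite /sg inversionsUr // exprD. Qed.

Lemma sg_swap v S : v \notin S -> sg S [set v] = (-1) ^+ #|S| * sg [set v] S.
Proof.
move=> vS; rewrite -(inversions1_swap vS) exprD -/(sg _ _) -/(sg _ _).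
by rewrite mulrC sgK.
Qed.

(** The element r u_S. Sums of these are all elements, which reduces identities
between additive maps to products of basis elements. *)
Definition delta S (r : R) : koszul V R := [ffun T => if T == S then r else 0].

Lemma delta0 S : delta S 0 = 0.
Proof. by apply/ffunP => T; rewrite !ffunE if_same. Qed.

Lemma deltaD S r t : delta S (r + t) = delta S r + delta S t.
Proof. by apply/ffunP => T; rewrite !ffunE; case: eqP; rewrite ?addr0. Qed.

Lemma koszul_basis a : a = \sum_S delta S (a S).
Proof.
apply/ffunP => T; rewrite sum_ffunE (bigD1 T) //= ffunE eqxx big1 ?addr0 //.
by move=> S ST; rewrite ffunE eq_sym (negPf ST).
Qed.

Lemma kmulBl b a c : kmul (a - c) b = kmul a b - kmul c b.
Proof.
apply/ffunP => U; rewrite !ffunE -sumrB; apply: eq_bigr => S _.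
by rewrite !ffunE mulrBl mulrBr.
Qed.

Lemma kmulBr a : {morph kmul a : b c / b - c}.
Proof.
move=> b c; apply/ffunP => U; rewrite !ffunE -sumrB; apply: eq_bigr => S _.
by rewrite !ffunE !mulrBr.
Qed.

Lemma kdiffB : {morph kdiff x : a b / a - b}.
Proof.
move=> a b; apply/ffunP => S; rewrite !ffunE -sumrB; apply: eq_bigr => v _.
by rewrite !ffunE !mulrBr.
Qed.

Lemma kbarB : {morph @kbar V R : a b / a - b}.
Proof. by move=> a b; apply/ffunP => S; rewrite !ffunE mulrBr. Qed.

HB.instance Definition _ a :=
  GRing.isZmodMorphism.Build _ _ (kmul a) (kmulBr a).
HB.instance Definition _ :=
  GRing.isZmodMorphism.Build _ _ (kdiff x) kdiffB.
HB.instance Definition _ :=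
  GRing.isZmodMorphism.Build _ _ (@kbar V R) kbarB.

Lemma kmul0l b : kmul 0 b = 0.
Proof. by have := kmulBl b 0 0; rewrite !subrr. Qed.

Lemma kmul_suml I (r : seq I) (P : pred I) (F : I -> koszul V R) b :
  kmul (\sum_(i <- r | P i) F i) b = \sum_(i <- r | P i) kmul (F i) b.
Proof.
apply: (big_morph (fun a => kmul a b)) => [a c|]; last exact: kmul0l.
by rewrite -[in LHS](opprK c) kmulBl -[- c]sub0r kmulBl kmul0l sub0r opprK.
Qed.

Lemma kmul_delta S T r t : kmul (delta S r) (delta T t) =
  if [disjoint S & T] then delta (S :|: T) (sg S T * (r * t)) else 0.
Proof.
apply/ffunP => U; rewrite ffunE.
have dUS (W : {set V}) : W \subset U -> [disjoint W & U :\: W].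
  by move=> _; rewrite -setI_eq0 setIDA setIC setDIl setDv setI0.
have [dST|dST] := boolP [disjoint S & T]; rewrite !ffunE.
  have [->|nU] := eqVneq U (S :|: T).
    have defT : (S :|: T) :\: S = T.
      by rewrite setDUl setDv set0U; apply/setDidPl; rewrite disjoint_sym.
    rewrite (bigD1 S) ?subsetUl //= !ffunE defT !eqxx big1 ?addr0 // => W.
    by case/andP=> _ nWS; rewrite !ffunE (negPf nWS) mul0r mulr0.
  rewrite big1 // => W sWU; rewrite !ffunE.
  case: eqP => [eWS|]; last by rewrite mul0r mulr0.
  case: eqP => [eWT|]; last by rewrite !mulr0.
  by case/eqP: nU; rewrite -eWT -eWS setDE setUIr setUCr setIT; apply/esym/setUidPr.
rewrite big1 // => W sWU; rewrite !ffunE.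
case: eqP => [eWS|]; last by rewrite mul0r mulr0.
case: eqP => [eWT|]; last by rewrite !mulr0.
by case/negP: dST; rewrite -eWS -eWT dUS.
Qed.

Lemma kdiff_delta S r :
  kdiff x (delta S r) = \sum_(v in S) delta (S :\ v) (sg [set v] (S :\ v) * (x v * r)).
Proof.
apply/ffunP => U; rewrite ffunE sum_ffunE [LHS]big_mkcond [RHS]big_mkcond /=.
apply: eq_bigr => v _; rewrite !ffunE.
have [-> |neU] := eqVneq U (S :\ v).
  have [vS|vS] := boolP (v \in S); first by rewrite !inE eqxx /= setD1K ?eqxx.
  rewrite ifT ?inE ?eqxx //; case: eqP => [eS|]; last by rewrite !mulr0.
  by rewrite -eS !inE eqxx in vS.
rewrite if_same; case: ifP => // vU; case: eqP => [eS|]; last by rewrite !mulr0.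
by case/eqP: neU; rewrite -eS setU1K.
Qed.

Lemma kbar_delta S r : kbar (delta S r) = delta S ((-1) ^+ #|S| * r).
Proof. by apply/ffunP => T; rewrite !ffunE; case: eqP => [->|]; rewrite ?mulr0. Qed.

Lemma kmulA : associative (@kmul V R).
Proof.
move=> a b c; rewrite [a]koszul_basis !kmul_suml; apply: eq_bigr => S _.
rewrite [b]koszul_basis kmul_suml !raddf_sum /= kmul_suml; apply: eq_bigr => T _.
rewrite [c]koszul_basis !raddf_sum; apply: eq_bigr => U _ /=.
move: (a S) (b T) (c U) => r t u; rewrite !kmul_delta.
have [dTU|dTU] := boolP [disjoint T & U]; last first.
  rewrite raddf0; case: ifP => dST; last by rewrite kmul0l.
  rewrite kmul_delta -setI_eq0 setIUl setU_eq0 !setI_eq0 (negPf dTU).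
  by rewrite andbF.
rewrite kmul_delta -[[disjoint S & _]]setI_eq0 setIUr setU_eq0 !setI_eq0.
have [dST|dST] := boolP [disjoint S & T]; last by rewrite kmul0l.
rewrite kmul_delta -[[disjoint S :|: T & _]]setI_eq0 setIUl setU_eq0 !setI_eq0 dTU andbT.
rewrite andTb; case: ifP => // dSU; rewrite setUA sgUr // sgUl //.
by congr (delta _ _); ring.
Qed.

Lemma kbarK : involutive (@kbar V R).
Proof. by move=> a; apply/ffunP => S; rewrite !ffunE mulrA -expr2 sqrr_sign mul1r. Qed.

Lemma kbarM : {morph @kbar V R : a b / kmul a b}.
Proof.
move=> a b; apply/ffunP => U; rewrite !ffunE mulr_sumr; apply: eq_bigr => S sSU.
rewrite !ffunE -(cardsID S U) (setIidPr sSU) exprD.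
by ring.
Qed.

Lemma kdiff_bar a : kdiff x (kbar a) = - kbar (kdiff x a).
Proof.
apply/ffunP => S; rewrite !ffunE mulr_sumr -sumrN; apply: eq_bigr => v vS.
by rewrite !ffunE cardsU1 vS exprD expr1; ring.
Qed.

(** Pairing v, w with w, v; the terms are ordered first so that no division by 2
is involved. *)
Lemma sum_antisym (F : V -> V -> koszul V R) :
  (forall v, F v v = 0) -> (forall v w, v != w -> F w v = - F v w) ->
  \sum_v \sum_w F v w = 0.
Proof.
move=> F0 Fopp.
pose lt v w := (enum_rank v < enum_rank w)%N.
pose G v w := if lt v w then F v w else 0.
rewrite (eq_bigr (fun v => \sum_w G v w - \sum_w G w v)).
  by rewrite sumrB [X in _ - X]exchange_big subrr.
move=> v _; rewrite -sumrB; apply: eq_bigr => w _; rewrite /G /lt.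
have [->|vw] := eqVneq v w; first by rewrite ltnn F0 subr0.
case: ltngtP => [_|_|/val_inj/enum_rank_inj/eqP]; rewrite ?subr0 //.
  by rewrite sub0r; apply: Fopp; rewrite eq_sym.
by rewrite (negPf vw).
Qed.

Lemma kdiffK a : kdiff x (kdiff x a) = 0.
Proof.
rewrite [a]koszul_basis !raddf_sum /= big1 // => S _; move: (a S) => r.
rewrite kdiff_delta raddf_sum.
pose F v w := if [&& v \in S, w \in S & v != w]
  then delta (S :\ v :\ w)
         (sg [set w] (S :\ v :\ w) * (x w * (sg [set v] (S :\ v) * (x v * r))))
  else 0.
rewrite big_mkcond (eq_bigr (fun v => \sum_w F v w)) /= => [|v _].
  apply: sum_antisym => [v|v w vw]; rewrite /F ?eqxx ?andbF //.
  rewrite andbCA eq_sym; case: ifP => [/and3P[vS wS _]|]; last by rewrite oppr0.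
  have -> : S :\ w :\ v = S :\ v :\ w by rewrite !setDDl setUC.
  set T := S :\ v :\ w.
  have dvT : [disjoint [set w] & T] by rewrite disjoints1 !inE eqxx.
  have dwT : [disjoint [set v] & T] by rewrite disjoints1 !inE eqxx andbF.
  have -> : S :\ v = [set w] :|: T by rewrite /T setD1K // !inE eq_sym vw.
  have -> : S :\ w = [set v] :|: T.
    by rewrite /T setDDl [[set v] :|: [set w]]setUC -setDDl setD1K // !inE vw.
  rewrite !sgUr // (@sg_swap v [set w]) ?inE // cards1 expr1.
  by apply/eqP; rewrite -addr_eq0 -deltaD; apply/eqP; rewrite -[RHS](delta0 T); congr delta; ring.
case: ifP => vS; last by rewrite big1 // => w _; rewrite /F vS.
rewrite kdiff_delta big_mkcond; apply: eq_bigr => w _.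
by rewrite /F vS !inE eq_sym andbC /=; case: (w \in S).
Qed.

(** On u_S and u_T with S and T disjoint this is the splitting of the boundary of
u_(S :|: T) according to the side of the removed element. If S and T meet, the
left hand side is zero; the terms on the right vanish unless S and T have exactly
one element v in common, and then one term remains on each side, the removal of
v from S and from T, with opposite signs. *)
Lemma kdiffM a b :
  kdiff x (kmul a b) = kmul (kdiff x a) b + kmul (kbar a) (kdiff x b).
Proof.
rewrite [a]koszul_basis kmul_suml !raddf_sum !kmul_suml -big_split /=.
apply: eq_bigr => S _.
rewrite [b]koszul_basis !raddf_sum -big_split; apply: eq_bigr => T _ /=.
move: (a S) (b T) => r t; rewrite kbar_delta kmul_delta !kdiff_delta.
rewrite kmul_suml raddf_sum /=.
under [X in _ = X + _]eq_bigr do rewrite kmul_delta.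
under [X in _ = _ + X]eq_bigr do rewrite kmul_delta.
have [dST|dST] := boolP [disjoint S & T].
  rewrite kdiff_delta big_setU_disjoint //; congr (_ + _); apply: eq_bigr => v vS.
    have vT : v \notin T by rewrite (disjointFr dST).
    have dvT : [disjoint S :\ v & T] by rewrite (disjointWl (subD1set _ _)).
    rewrite dvT setDUl (_ : T :\ v = T); last first.
      by apply/setDidPl; rewrite disjoint_sym disjoints1.
    rewrite -[in sg S T](setD1K vS) sgUl ?sgUr ?disjoints1 ?setD11 //.
    congr delta; rewrite -[RHS](sgK [set v] T); ring.
  have vS' : v \notin S by rewrite (disjointFl dST).
  have dvT : [disjoint S & T :\ v] by rewrite (disjointWr (subD1set _ _)).
  rewrite dvT setDUl (_ : S :\ v = S); last first.
    by apply/setDidPl; rewrite disjoint_sym disjoints1.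
  rewrite -[in sg S T](setD1K vS) !sgUr ?disjoints1 ?setD11 // sg_swap //.
  congr delta; rewrite -[RHS](sgK [set v] S); ring.
have meet v : v \in S -> [disjoint S :\ v & T] = (S :&: T == [set v]).
  move=> vS; rewrite -setI_eq0 setIDAC setD_eq0 subset1.
  by rewrite setI_eq0 (negPf dST) orbF.
have meet' v : v \in T -> [disjoint S & T :\ v] = (S :&: T == [set v]).
  move=> vS; rewrite -setI_eq0 setIDA setD_eq0 subset1.
  by rewrite setI_eq0 (negPf dST) orbF.
rewrite raddf0 [X in _ = X + _]big_mkcond [X in _ = _ + X]big_mkcond -big_split.
rewrite big1 // => v _ /=.
have [eST|nST] := eqVneq (S :&: T) [set v]; last first.
  case: ifP => vS; rewrite ?meet ?(negPf nST) //;
  by case: ifP => vT; rewrite ?meet' ?(negPf nST) // add0r.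
have /setIP[vS vT] : v \in S :&: T by rewrite eST set11.
rewrite vS vT meet // meet' // eST eqxx.
have dvST : [disjoint S :\ v & T :\ v].
  by apply: disjointWr (subD1set _ _) _; rewrite meet // eST.
have -> : S :|: T :\ v = S :\ v :|: T.
  by rewrite -{1}(setD1K vS) setUAC [in X in X = _]setUC (setD1K vT) setUC.
rewrite -[in sg (S :\ v) T](setD1K vT) -[in sg S (T :\ v)](setD1K vS).
have -> : (-1) ^+ #|S| = - (-1) ^+ #|S :\ v| :> R.
  by rewrite (cardsD1 v S) vS exprS mulN1r.
rewrite sgUl ?sgUr ?disjoints1 ?setD11 // sg_swap ?setD11 //.
rewrite -deltaD -[RHS](delta0 (S :\ v :|: T)); congr delta.
set s1 := sg [set v] (S :\ v); set s2 := sg [set v] (T :\ v).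
have e1 : s1 * s1 = 1 by rewrite -[RHS](sgK [set v] (S :\ v)) mulr1.
have e2 : s2 * s2 = 1 by rewrite -[RHS](sgK [set v] (T :\ v)) mulr1.
transitivity ((s1 * s1 - s2 * s2) * ((-1) ^+ #|S :\ v| * sg (S :\ v) (T :\ v) * x v * r * t)).
  by ring.
by rewrite e1 e2 subrr mul0r.
Qed.

Fact homogeneous0 n : homogeneous n (0 : koszul V R).
Proof. by move=> S _; rewrite ffunE. Qed.

Fact homogeneousB n a b : homogeneous n a -> homogeneous n b -> homogeneous n (a - b).
Proof. by move=> ha hb S nS; rewrite !ffunE ha // hb // subr0. Qed.

Fact homogeneous_bar n a : homogeneous n a -> homogeneous n (kbar a).
Proof. by move=> ha S nS; rewrite !ffunE ha // mulr0. Qed.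

Fact homogeneous_diff n a : homogeneous n.+1 a -> homogeneous n (kdiff x a).
Proof.
move=> ha S nS; rewrite ffunE big1 // => v vS.
by rewrite ha ?mulr0 // cardsU1 vS eqSS.
Qed.

Fact homogeneousM n m a b :
  homogeneous n a -> homogeneous m b -> homogeneous (n + m) (kmul a b).
Proof.
move=> ha hb U nU; rewrite ffunE big1 // => S sSU.
have [eS|nS] := eqVneq #|S| n; last by rewrite ha // mul0r mulr0.
rewrite hb ?mulr0 //; apply: contra nU => /eqP eT.
by rewrite -(cardsID S U) (setIidPr sSU) eS eT.
Qed.

Definition koszul_dga := @Dga (koszul V R) (@kmul V R) (kdiff x) (@kbar V R)
  (@homogeneous V R) kmulBl kmulBr kmulA kdiffB kbarB kbarK kbarM kdiffK kdiff_bar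
  kdiffM homogeneous0 homogeneousB homogeneous_bar homogeneous_diff homogeneousM.

(** Only the component in degree n + 1 of a bounding chain contributes. *)
Lemma koszul_graded_boundary n (a : koszul_dga) : ddeg n a -> dboundary a ->
  exists2 c : koszul_dga, ddeg n.+1 c & a = ddiff c.
Proof.
move=> da [b eb]; pose c : koszul V R := [ffun S : {set V} =>
  if #|S| == n.+1 then (b : koszul V R) S else 0].
exists c; first by move=> S nS; rewrite ffunE (negPf nS).
apply/ffunP => S; rewrite [RHS]ffunE.
have [eS|nS] := eqVneq #|S| n; last first.
  rewrite da // big1 // => v vS.
  by rewrite ffunE cardsU1 vS eqSS (negPf nS) !mulr0.
rewrite eb [LHS]ffunE; apply: eq_bigr => v vS.
by rewrite ffunE cardsU1 vS eS eqxx.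
Qed.

Lemma trivial_multiplicationE :
  trivial_multiplication x <-> trivial_products koszul_dga.
Proof. by []. Qed.

Lemma trivial_masseyE : trivial_massey x <-> trivial_higher koszul_dga.
Proof. by []. Qed.

End KoszulBasis.

(** * Morphisms of Koszul algebras *)

Section KoszulMap.
Local Open Scope ring_scope.
Variables (V W : finType) (s : V -> W).
Hypothesis s_inj : injective s.
Variables (R R' : comNzRingType) (theta : {rmorphism R -> R'}).
Variables (x : V -> R) (x' : W -> R') (y : V -> R').
Hypothesis theta_x : forall v, theta (x v) = x' (s v) * y v.
Implicit Types (T U : {set V}) (S : {set W}).

Definition discordance (v w : V) : nat :=
  ((enum_rank v < enum_rank w) && (enum_rank (s w) < enum_rank (s v)))%N.

(** The injection s need not be compatible with the enumerations of V and W that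
fix the order of the exterior generators. The image of u_T is therefore the
product of the images of the u_v in the order of V, and [shuffle] counts the
transpositions that bring it to the order of W. *)
Definition shuffle T : nat := (\sum_(v in T) \sum_(w in T) discordance v w)%N.

(** For v in T and w in U, both sides count, modulo 2, whether s v and s w are in
the wrong order. *)
Lemma shuffleU T U : [disjoint T & U] ->
  (shuffle (T :|: U) + inversions T U =
   shuffle T + shuffle U + inversions (s @: T) (s @: U)
   + 2 * \sum_(v in T) \sum_(w in U) discordance w v)%N.
Proof.
move=> dTU.
have -> : inversions (s @: T) (s @: U) =
    (\sum_(v in T) \sum_(w in U) (enum_rank (s w) < enum_rank (s v)))%N.
  rewrite inversionsE big_imset; last by move=> ? ? ? ?; apply: s_inj.
  apply: eq_bigr => v vT; rewrite big_imset //.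
  by move=> ? ? ? ?; apply: s_inj.
rewrite inversionsE /shuffle big_setU_disjoint //=.
under eq_bigr do rewrite big_setU_disjoint //=.
under [X in (_ + X + _)%N]eq_bigr do rewrite big_setU_disjoint //=.
rewrite !big_split /= [X in (_ + (X + _) + _)%N]exchange_big /=.
set A := (\sum_(v in T) \sum_(w in T) _)%N.
set B := (\sum_(v in U) \sum_(w in U) _)%N.
set C := (\sum_(v in T) \sum_(w in U) discordance v w)%N.
set D := (\sum_(v in T) \sum_(w in U) discordance w v)%N.
set E := (\sum_(v in T) \sum_(w in U) _)%N.
set F := (\sum_(v in T) \sum_(w in U) _)%N.
suff: (C + D + E = F + 2 * D)%N by lia.
rewrite /C /D /E /F big_distrr /= -!big_split; apply: eq_bigr => v vT.
rewrite big_distrr /= -!big_split; apply: eq_bigr => w wU /=.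
have vw : v != w by apply: contraTneq wU => <-; rewrite (disjointFr dTU).
have: enum_rank v != enum_rank w by rewrite (inj_eq enum_rank_inj).
have: enum_rank (s v) != enum_rank (s w).
  by rewrite (inj_eq enum_rank_inj) (inj_eq s_inj).
rewrite -!val_eqE /discordance /=.
by case: (ltngtP (enum_rank v) (enum_rank w)) => //; case: (ltngtP (enum_rank (s v))) => //.
Qed.

Definition eps T : R' := (-1) ^+ shuffle T.

Lemma epsU T U : [disjoint T & U] ->
  eps (T :|: U) * sg R' T U = eps T * eps U * sg R' (s @: T) (s @: U).
Proof.
move=> dTU; rewrite -!exprD shuffleU // exprD [X in _ * X]exprM.
by rewrite sqrrN expr1n expr1n mulr1.
Qed.

Definition weight T : R' := \prod_(v in T) y v.

(** The morphism of exterior algebras over theta with u_v |-> y_v u_(s v). It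
commutes with the differentials because theta (x_v) = x'_(s v) y_v. *)
Definition koszul_map (a : koszul V R) : koszul W R' :=
  [ffun S : {set W} => \sum_(T : {set V} | s @: T == S) eps T * (theta (a T) * weight T)].

Lemma koszul_mapB : {morph koszul_map : a b / a - b}.
Proof.
move=> a b; apply/ffunP => S; rewrite !ffunE -sumrB; apply: eq_bigr => T _.
by rewrite !ffunE rmorphB /=; ring.
Qed.

HB.instance Definition _ :=
  GRing.isZmodMorphism.Build _ _ koszul_map koszul_mapB.

Lemma koszul_map_at a T : koszul_map a (s @: T) = eps T * (theta (a T) * weight T).
Proof.
rewrite ffunE (big_pred1 T) // => U.
by rewrite (inj_eq (imset_inj s_inj)).
Qed.

Lemma koszul_map_out a S : ~~ (S \subset codom s) -> koszul_map a S = 0.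
Proof.
move=> nS; rewrite ffunE big1 // => T /eqP eS; case/negP: nS; rewrite -eS.
by apply/subsetP => _ /imsetP[v _ ->]; apply: codom_f.
Qed.

Lemma koszul_map_delta T r :
  koszul_map (delta T r) = delta (s @: T) (eps T * (theta r * weight T)).
Proof.
apply/ffunP => S; rewrite !ffunE; case: eqP => [->|/eqP nS].
  rewrite (big_pred1 T) => [|U]; first by rewrite ffunE eqxx.
  by rewrite (inj_eq (imset_inj s_inj)).
rewrite big1 // => U /eqP eU; rewrite ffunE; case: eqP => [eUT|_].
  by rewrite -eU eUT eqxx in nS.
by rewrite rmorph0 mul0r mulr0.
Qed.

Lemma koszul_mapM : {morph koszul_map : a b / kmul a b}.
Proof.
move=> a b; rewrite [a]koszul_basis !(kmul_suml, raddf_sum) /=.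
apply: eq_bigr => T _; rewrite [b]koszul_basis !raddf_sum; apply: eq_bigr => U _ /=.
move: (a T) (b U) => r t; rewrite !koszul_map_delta !kmul_delta.
have -> : [disjoint s @: T & s @: U] = [disjoint T & U].
  by rewrite -!setI_eq0 -imsetI ?imset_eq0 // => ? ? ? ?; apply: s_inj.
have [dTU|_] := boolP [disjoint T & U]; last exact: raddf0.
rewrite koszul_map_delta imsetU; congr delta.
rewrite /weight big_setU_disjoint //= !rmorphM /= rmorph_sign -/(sg R' T U).
set p := \prod_(v in T) _; set q := \prod_(v in U) _.
transitivity (eps (T :|: U) * sg R' T U * (theta r * theta t * p * q)); first ring.
by rewrite epsU //; ring.
Qed.

Lemma koszul_map_diff : {morph koszul_map : a / kdiff x a >-> kdiff x' a}.
Proof.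
move=> a; rewrite [a]koszul_basis !raddf_sum; apply: eq_bigr => T _ /=.
move: (a T) => r; rewrite koszul_map_delta !kdiff_delta raddf_sum /=.
rewrite big_imset; last by move=> ? ? ? ?; apply: s_inj.
apply: eq_bigr => v vT; rewrite koszul_map_delta.
have -> : s @: T :\ s v = s @: (T :\ v).
  apply/setP => w; rewrite !inE; apply/andP/imsetP => [[nw /imsetP[u uT ew]]|[u]].
    exists u => //; rewrite !inE uT andbT; apply: contraNneq nw => <-.
    by rewrite ew.
  by rewrite !inE => /andP[nu uT] ->; rewrite (inj_eq s_inj) nu imset_f.
congr delta; rewrite !rmorphM /= rmorph_sign -/(sg R' _ _) theta_x /weight.
rewrite [X in _ = _ * (_ * (_ * (_ * X)))](big_setD1 v) //=.
have dv : [disjoint [set v] & T :\ v] by rewrite disjoints1 setD11.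
have := epsU dv; rewrite setD1K // imset_set1.
have -> : eps [set v] = 1.
  by rewrite /eps /shuffle !big_set1 /discordance ltnn.
rewrite mul1r.
set e := eps T; set e' := eps _; set sg1 := sg _ _ _; set sg2 := sg _ _ _ => E.
set p := \prod_(u in _) _.
have -> : e' = e * sg1 * sg2 by rewrite E -mulrA -expr2 sqrr_sign mulr1.
have sg1K : sg1 * sg1 = 1 by rewrite -expr2 sqrr_sign.
by rewrite -[RHS]mul1r -sg1K; ring.
Qed.

Lemma koszul_map_bar : {morph koszul_map : a / kbar a}.
Proof.
move=> a; apply/ffunP => S; rewrite !ffunE mulr_sumr; apply: eq_bigr => T /eqP <-.
by rewrite ffunE rmorphM rmorph_sign card_imset //=; ring.
Qed.

Lemma koszul_map_homogeneous n a : homogeneous n a -> homogeneous n (koszul_map a).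
Proof.
move=> ha S nS; rewrite ffunE big1 // => T /eqP eT.
by rewrite ha ?rmorph0 ?mul0r ?mulr0 // -(card_imset _ s_inj) eT.
Qed.

Definition koszul_hom : dga_hom (koszul_dga x) (koszul_dga x') :=
  @DgaHom (koszul_dga x) (koszul_dga x') koszul_map koszul_mapB koszul_mapM
    koszul_map_diff koszul_map_bar koszul_map_homogeneous.

End KoszulMap.

(** * Monomials and coefficients in face rings *)

Section FaceRingMonomials.
Local Open Scope ring_scope.
Variables (k : comNzRingType) (V : finType) (K : scomplex V).

Local Notation R := (face_ring k K).
Local Notation x := (face_ring_var k K).
Local Notation P := {mpoly k[#|V|]}.
Implicit Types (c d : {ffun V -> nat}) (S : {set V}).

Definition face_proj (p : P) : R := \pi_{ideal_quot (@face_ideal k V K)}%qT p.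

Fact face_projB : {morph face_proj : p q / p - q}.
Proof. exact: (raddfB (\pi_{ideal_quot (@face_ideal k V K)}%qT)). Qed.

Fact face_projM : monoid_morphism face_proj.
Proof.
split; first exact: (rmorph1 (\pi_{ideal_quot (@face_ideal k V K)}%qT)).
exact: (rmorphM (\pi_{ideal_quot (@face_ideal k V K)}%qT)).
Qed.

HB.instance Definition _ := GRing.isZmodMorphism.Build P R face_proj face_projB.
HB.instance Definition _ := GRing.isMonoidMorphism.Build P R face_proj face_projM.

Lemma face_proj_eq p q : face_proj p = face_proj q <-> p - q \in @face_ideal k V K.
Proof.
rewrite Quotient.idealrBE; split=> [e|/eqP e]; last exact: e.
by apply/eqP; apply: e.
Qed.

Definition face_repr (r : R) : P := repr r.

Lemma face_reprK r : face_proj (face_repr r) = r.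
Proof. exact: reprK. Qed.

Definition scal (t : k) : R := face_proj t%:MP.

Fact scalB : {morph scal : s t / s - t}.
Proof. by move=> s t; rewrite /scal !rmorphB. Qed.

Fact scalM : monoid_morphism scal.
Proof. by split=> [|s t]; rewrite /scal ?rmorph1 ?rmorphM. Qed.

HB.instance Definition _ := GRing.isZmodMorphism.Build k R scal scalB.
HB.instance Definition _ := GRing.isMonoidMorphism.Build k R scal scalM.

Definition supp (c : V -> nat) : {set V} := [set v | (0 < c v)%N].
Definition mon (c : V -> nat) : R := \prod_v x v ^+ c v.

Lemma monM (c d : V -> nat) : mon c * mon d = mon (fun v => c v + d v)%N.
Proof. by rewrite -big_split; apply: eq_bigr => v _; rewrite exprD. Qed.

Lemma eq_mon (c d : V -> nat) : c =1 d -> mon c = mon d.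
Proof. by move=> e; apply: eq_bigr => v _; rewrite e. Qed.

Lemma mon_set S : \prod_(v in S) x v = mon (fun v => v \in S).
Proof. by rewrite big_mkcond; apply: eq_bigr => v _; case: (v \in S). Qed.

Lemma var_mon v : x v = mon (fun w => w \in [set v]).
Proof. by rewrite -mon_set big_set1. Qed.

Lemma face_proj_monomial S : face_proj (face_monomial k S) = \prod_(v in S) x v.
Proof. exact: rmorph_prod. Qed.

Lemma prod_nonface S : S \notin faces K -> \prod_(v in S) x v = 0.
Proof.
move=> nS; rewrite -face_proj_monomial -[RHS](raddf0 face_proj).
apply/face_proj_eq; rewrite subr0; apply/asboolP.
exists (fun T => (T == S)%:R); rewrite (bigD1 S) //= eqxx mul1r big1 ?addr0 //.
by move=> T /andP[_ /negPf->]; rewrite mul0r.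
Qed.

Lemma mon_nonface (c : V -> nat) : supp c \notin faces K -> mon c = 0.
Proof.
move=> nc; rewrite (@eq_mon _ (fun v => (v \in supp c) + (c v).-1)%N) => [|v].
  by rewrite -(monM (fun v => v \in supp c)) -mon_set prod_nonface ?mul0r.
by rewrite inE; case: (c v).
Qed.

Definition mnm_of (c : V -> nat) : 'X_{1..#|V|} := [multinom c (enum_val i) | i < #|V|].
Definition expo_of (m : 'X_{1..#|V|}) : {ffun V -> nat} := [ffun v => m (enum_rank v)].

Lemma mnm_ofK c : expo_of (mnm_of c) = c.
Proof. by apply/ffunP => v; rewrite ffunE mnmE enum_rankK. Qed.

Lemma expo_ofK m : mnm_of (expo_of m) = m.
Proof. by apply/mnmP => i; rewrite mnmE ffunE enum_valK. Qed.

Lemma mon_proj (c : V -> nat) : mon c = face_proj 'X_[mnm_of c].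
Proof.
rewrite mpolyXE_id rmorph_prod (reindex (@enum_rank V)); last first.
  by apply: onW_bij; apply: enum_rank_bij.
by apply: eq_bigr => v _; rewrite rmorphXn /= mnmE enum_rankK.
Qed.

Lemma face_monomialE S : face_monomial k S = 'X_[mnm_of (fun v => v \in S)].
Proof.
rewrite mpolyXE_id (reindex (@enum_rank V)); last first.
  by apply: onW_bij; apply: enum_rank_bij.
rewrite /face_monomial big_mkcond; apply: eq_bigr => v _.
by rewrite mnmE enum_rankK; case: (v \in S).
Qed.

(** A multiple of the monomial of a nonface S only involves monomials whose
support contains S, and such a support is not a face. *)
Lemma ideal_coef0 (p : P) c :
  p \in @face_ideal k V K -> supp c \in faces K -> p@_(mnm_of c) = 0.
Proof.
move=> /asboolP[q ->] fc; rewrite raddf_sum big1 //= => S nS.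
have /subsetPn[v vS vc] : ~~ (S \subset supp c).
  by apply: contra nS => sSc; apply: face_sub sSc fc.
rewrite face_monomialE memN_msupp_eq0 // (perm_mem (msuppMX _ _)).
apply/mapP => -[m _ /(congr1 (fun m : 'X_{1..#|V|} => m (enum_rank v)))].
rewrite mnmDE !mnmE enum_rankK vS; move: vc; rewrite inE -leqNgt leqn0.
by move=> /eqP->; case: (m _).
Qed.

(** The monomials with support a face are a basis of the face ring; [coef] reads
off the coordinates. *)
Definition coef c (r : R) : k :=
  if supp c \in faces K then (face_repr r)@_(mnm_of c) else 0.

Lemma coef_proj c p : supp c \in faces K -> coef c (face_proj p) = p@_(mnm_of c).
Proof.
move=> fc; rewrite /coef fc; apply/eqP; rewrite -subr_eq0 -mcoeffB.
by rewrite ideal_coef0 //; apply/face_proj_eq; rewrite face_reprK.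
Qed.

Lemma coef_nonface c r : supp c \notin faces K -> coef c r = 0.
Proof. by rewrite /coef => /negPf->. Qed.

Fact coefB c : {morph coef c : r s / r - s}.
Proof.
move=> r s; have [fc|nc] := boolP (supp c \in faces K); last first.
  by rewrite !coef_nonface // subr0.
by rewrite -[r]face_reprK -[s]face_reprK -face_projB !coef_proj // mcoeffB.
Qed.

HB.instance Definition _ c := GRing.isZmodMorphism.Build R k (coef c) (coefB c).

Lemma coef_mon c (d : V -> nat) t :
  coef c (scal t * mon d) = if (c == finfun d) && (supp c \in faces K) then t else 0.
Proof.
have [fc|nc] := boolP (supp c \in faces K); last by rewrite coef_nonface // andbF.
rewrite mon_proj /scal -rmorphM coef_proj // mcoeffCM mcoeffX andbT.
have -> : (mnm_of d == mnm_of c) = (c == finfun d).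
  have -> : mnm_of d = mnm_of (finfun d).
    by apply/mnmP => i; rewrite !mnmE ffunE.
  by rewrite eq_sym (can_eq mnm_ofK).
by case: eqP; rewrite ?mulr1 ?mulr0.
Qed.

Lemma face_proj_sum (p : P) :
  face_proj p = \sum_(m <- msupp p) scal p@_m * mon (expo_of m).
Proof.
rewrite {1}[p]mpolyE raddf_sum; apply: eq_bigr => m _ /=.
by rewrite mon_proj expo_ofK /scal -rmorphM mul_mpolyC.
Qed.

Lemma coef_eq0 r : (forall c, coef c r = 0) -> r = 0.
Proof.
move=> r0; rewrite -(face_reprK r) face_proj_sum big1 // => m _.
have [fm|nm] := boolP (supp (expo_of m) \in faces K); last first.
  by rewrite mon_nonface ?mulr0.
have := r0 (expo_of m); rewrite /coef fm expo_ofK => ->.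
by rewrite raddf0 mul0r.
Qed.

Lemma coef_support r : exists l : seq {ffun V -> nat}, forall c, c \notin l -> coef c r = 0.
Proof.
exists (map expo_of (msupp (face_repr r))) => c nc; rewrite /coef; case: ifP => // _.
apply: memN_msupp_eq0; apply: contra nc => /(map_f expo_of).
by rewrite mnm_ofK.
Qed.

Section Lift.
Variables (R' : comNzRingType) (h : {rmorphism k -> R'}) (z : V -> R').
Hypothesis z_nonface : forall S, S \notin faces K -> \prod_(v in S) z v = 0.

(** The universal property of the face ring, by evaluation of a representative. *)
Definition face_lift (r : R) : R' := mmap h (fun i => z (enum_val i)) (face_repr r).

Lemma face_lift_proj p : face_lift (face_proj p) = mmap h (fun i => z (enum_val i)) p.
Proof.
apply/eqP; rewrite -subr_eq0 -mmapB.
have : face_repr (face_proj p) - p \in @face_ideal k V K.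
  by apply/face_proj_eq; rewrite face_reprK.
case/asboolP => q ->; rewrite raddf_sum big1 //= => S nS.
rewrite rmorphM rmorph_prod /= (eq_bigr z) ?z_nonface ?mulr0 // => v _.
by rewrite mmapX mmap1U enum_rankK.
Qed.

Fact face_liftB : {morph face_lift : r s / r - s}.
Proof.
move=> r s; rewrite -[r]face_reprK -[s]face_reprK -face_projB !face_lift_proj.
exact: raddfB.
Qed.

Fact face_liftM : monoid_morphism face_lift.
Proof.
split=> [|r s]; first by rewrite -[1](rmorph1 face_proj) face_lift_proj rmorph1.
rewrite -[r]face_reprK -[s]face_reprK -(rmorphM face_proj) !face_lift_proj.
exact: rmorphM.
Qed.

HB.instance Definition _ := GRing.isZmodMorphism.Build R R' face_lift face_liftB.
HB.instance Definition _ := GRing.isMonoidMorphism.Build R R' face_lift face_liftM.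

Definition face_lift_hom : {rmorphism R -> R'} := face_lift.

Lemma face_lift_var v : face_lift_hom (x v) = z v.
Proof. by rewrite /= (face_lift_proj 'X_(enum_rank v)) mmapX mmap1U enum_rankK. Qed.

Lemma face_lift_scal t : face_lift_hom (scal t) = h t.
Proof. by rewrite /scal /= face_lift_proj mmapC. Qed.

End Lift.

End FaceRingMonomials.

Section MonomialPowers.
Local Open Scope ring_scope.
Variables (k : comNzRingType) (V : finType) (K : scomplex V).

Lemma mon0 : mon k K (fun=> 0%N) = 1.
Proof. by rewrite /mon big1 // => v _; rewrite expr0. Qed.

Lemma mon_prod (I : finType) (F : I -> V -> nat) :
  \prod_i mon k K (F i) = mon k K (fun v => \sum_i F i v)%N.
Proof.
rewrite /mon exchange_big; apply: eq_bigr => v _ /=.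
by rewrite (big_morph (fun n => face_ring_var k K v ^+ n) (exprD _) (expr0 _)).
Qed.

Lemma monX (c : V -> nat) n : mon k K c ^+ n = mon k K (fun v => c v * n)%N.
Proof. by rewrite -prodrXl; apply: eq_bigr => v _; rewrite exprM. Qed.

End MonomialPowers.

(** * The multigrading of the Koszul algebra of a face ring *)

Section DegreeParts.
Local Open Scope ring_scope.
Variables (k : comNzRingType) (V : finType) (K : scomplex V).
Local Notation R := (face_ring k K).
Local Notation x := (face_ring_var k K).
Local Notation expo := {ffun V -> nat}.
Implicit Types (c d : expo) (S T : {set V}) (al : koszul V k) (a : koszul V R).

Definition lower c S : expo := [ffun v => c v - (v \in S)]%N.
(** [cell c S] holds when x^(c - 1_S) u_S is a nonzero element of degree c. *)
Definition cell c S := (S \subset supp c) && (supp (lower c S) \in faces K).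
Definition supp_ind c : V -> k := fun v => (0 < c v)%N%:R.

(** [mincl c] and [mpart c] are the inclusion of and the projection to the part
of degree c, in the coordinates where x^(c - 1_S) u_S stands for S. In these
coordinates the variables disappear from the differential: it becomes the Koszul
differential over k with all the elements of the support of c acting by 1. *)
Definition mincl c al : koszul V R :=
  [ffun S : {set V} => if S \subset supp c then scal K (al S) * mon k K (lower c S) else 0].
Definition mpart c a : koszul V k :=
  [ffun S : {set V} => if S \subset supp c then coef (lower c S) (a S) else 0].

Fact minclB c : {morph mincl c : a b / a - b}.
Proof.
move=> a b; apply/ffunP => S; rewrite !ffunE; case: ifP => _; last by rewrite subr0.
by rewrite rmorphB mulrBl.
Qed.

Fact mpartB c : {morph mpart c : a b / a - b}.
Proof.
move=> a b; apply/ffunP => S; rewrite !ffunE; case: ifP => _; last by rewrite subr0.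
exact: coefB.
Qed.

HB.instance Definition _ c := GRing.isZmodMorphism.Build _ _ (mincl c) (minclB c).
HB.instance Definition _ c := GRing.isZmodMorphism.Build _ _ (mpart c) (mpartB c).

Lemma mincl_diff c al : kdiff x (mincl c al) = mincl c (kdiff (supp_ind c) al).
Proof.
apply/ffunP => S; rewrite [LHS]ffunE [RHS]ffunE.
have [sS|nS] := boolP (S \subset supp c); last first.
  apply: big1 => v vS; rewrite ffunE ifF ?mulr0 //.
  by rewrite subUset (negPf nS) andbF.
rewrite ffunE rmorph_sum mulr_suml; apply: eq_bigr => v vS.
rewrite ffunE subUset sS andbT sub1set inE /supp_ind.
case: ltnP => [cv|_]; last by rewrite mul0r !mulr0 rmorph0 mul0r.
rewrite !rmorphM rmorph_sign rmorph1 mul1r /= -mulrA; congr (_ * _).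
rewrite mulrCA; congr (_ * _); rewrite var_mon monM.
apply: eq_mon => w; rewrite !ffunE !inE; have [->|] := eqVneq w v => //=.
by rewrite (negPf vS) subn0 subnKC.
Qed.

Lemma homogeneous_mincl n c al : homogeneous n al -> homogeneous n (mincl c al).
Proof.
by move=> ha S nS; rewrite ffunE ha // raddf0 mul0r if_same.
Qed.

Lemma homogeneous_mpart n c a : homogeneous n a -> homogeneous n (mpart c a).
Proof. by move=> ha S nS; rewrite ffunE ha // raddf0 if_same. Qed.

Lemma mincl_eq0 c al : (forall S, cell c S -> al S = 0) -> mincl c al = 0.
Proof.
move=> al0; apply/ffunP => S; rewrite !ffunE; case: ifP => // sS.
have [fS|nS] := boolP (supp (lower c S) \in faces K).
  by rewrite al0 /cell ?sS // raddf0 mul0r.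
by rewrite mon_nonface ?mulr0.
Qed.

Lemma mpart_noncell c a S : ~~ cell c S -> mpart c a S = 0.
Proof.
rewrite /cell ffunE; case: ifP => //= _ nS; exact: coef_nonface.
Qed.

Lemma mpart_mincl c d al S :
  mpart c (mincl d al) S = if (c == d) && cell c S then al S else 0.
Proof.
have [gS|nS] := boolP (cell c S); last by rewrite mpart_noncell // andbF.
have /andP[sS fS] := gS; rewrite !ffunE sS andbT.
case: ifP => sdS; last first.
  by rewrite raddf0; case: eqP => // ecd; rewrite -ecd sS in sdS.
rewrite coef_mon fS andbT.
have -> : finfun (lower d S) = lower d S by apply/ffunP => v; rewrite ffunE.
suff -> : (lower c S == lower d S) = (c == d) by [].
apply/eqP/eqP => [/ffunP e|-> //]; apply/ffunP => v.
have := e v; rewrite !ffunE; have [vS|_] := boolP (v \in S); last by rewrite !subn0.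
have := subsetP sS v vS; have := subsetP sdS v vS; rewrite !inE.
by case: (c v) => //; case: (d v) => // i j _ _; rewrite !subn1 /= => ->.
Qed.

Lemma mpart_sum c (l : seq expo) (al : expo -> koszul V k) S : uniq l ->
  mpart c (\sum_(d <- l) mincl d (al d)) S = if (c \in l) && cell c S then al c S else 0.
Proof.
move=> ul; rewrite raddf_sum sum_ffunE.
rewrite (eq_bigr (fun d => if c == d then if cell c S then al c S else 0 else 0)).
  rewrite -big_mkcond; case: (boolP (c \in l)) => cl.
    rewrite -big_filter; have -> : [seq d <- l | c == d] = [:: c].
      by rewrite (eq_filter (a2 := pred1 c)) ?filter_pred1_uniq // => d; rewrite /= eq_sym.
    by rewrite big_seq1.
  rewrite big_seq_cond big1 // => d /andP[dl /eqP ecd].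
  by rewrite -ecd (negPf cl) in dl.
by move=> d _; rewrite mpart_mincl; case: eqP => // ->.
Qed.

Lemma mpart_eq0 a : (forall c, mpart c a = 0) -> a = 0.
Proof.
move=> a0; apply/ffunP => S; rewrite ffunE; apply: coef_eq0 => d.
pose c : expo := [ffun v => d v + (v \in S)]%N.
have := congr1 (fun al : koszul V k => al S) (a0 c); rewrite !ffunE ifT.
  suff -> : lower c S = d by [].
  by apply/ffunP => v; rewrite !ffunE addnK.
by apply/subsetP => v vS; rewrite inE ffunE vS addn1.
Qed.

Lemma mpart_decomposition a : exists2 l : seq expo, uniq l &
  a = \sum_(c <- l) mincl c (mpart c a).
Proof.
have [l0 l0P] := choice (fun S => coef_support (a S)).
pose up S d : expo := [ffun v => d v + (v \in S)]%N.
pose l := undup (flatten [seq [seq up U d | d <- l0 U] | U <- enum {: {set V}}]).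
have out c : c \notin l -> mpart c a = 0.
  move=> cl; apply/ffunP => S; rewrite !ffunE; case: ifP => // sS.
  apply: l0P; apply: contra cl => dl; rewrite mem_undup.
  apply/flatten_mapP; exists S; rewrite ?mem_enum //.
  apply/mapP; exists (lower c S) => //; apply/ffunP => v; rewrite !ffunE.
  by rewrite subnK //; case: (boolP (v \in S)) => // /(subsetP sS); rewrite inE.
exists l; first exact: undup_uniq.
apply/eqP; rewrite -subr_eq0; apply/eqP/mpart_eq0 => c; rewrite mpartB.
apply/eqP; rewrite subr_eq0; apply/eqP/ffunP => S; rewrite mpart_sum ?undup_uniq //.
have [gS|nS] := boolP (cell c S); last by rewrite mpart_noncell // andbF.
rewrite andbT; case: (boolP (c \in l)) => // cl.
by rewrite out // ffunE.
Qed.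

Lemma mpart_diff c a S : cell c S -> mpart c (kdiff x a) S = kdiff (supp_ind c) (mpart c a) S.
Proof.
move=> gS; have [l ul ea] := mpart_decomposition a.
rewrite {1}ea raddf_sum /=; under eq_bigr do rewrite mincl_diff.
rewrite mpart_sum // gS andbT; case: (boolP (c \in l)) => // cl.
suff -> : mpart c a = 0 by rewrite raddf0 ffunE.
by apply/ffunP => T; rewrite {1}ea mpart_sum // (negPf cl) /= ffunE.
Qed.

(** Enlarging S can only shrink the support of c - 1_S. *)
Lemma cell_add c S v : cell c S -> (0 < c v)%N -> cell c (v |: S).
Proof.
case/andP=> sS fS cv; apply/andP; split; first by rewrite subUset sub1set inE cv.
apply: face_sub fS; apply/subsetP => w; rewrite !inE !ffunE.
by move=> /leq_trans; apply; rewrite leq_sub2l // in_setU1; case: (w \in S); rewrite ?orbT.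
Qed.

End DegreeParts.

(** * Contractions by left multiplication *)

Section LeftMultiplication.
Local Open Scope ring_scope.
Variables (k : comNzRingType) (V : finType).
Implicit Types (al : koszul V k) (S : {set V}).

Definition lmul v al : koszul V k := kmul (delta [set v] 1) al.

Lemma lmulE v al S :
  lmul v al S = if v \in S then sg k [set v] (S :\ v) * al (S :\ v) else 0.
Proof.
rewrite ffunE; case: ifP => vS.
  rewrite (bigD1 [set v]) ?sub1set //= big1 ?addr0 => [|T /andP[_ nT]].
    by rewrite ffunE eqxx mul1r.
  by rewrite ffunE (negPf nT) mul0r mulr0.
rewrite big1 // => T sTS; rewrite ffunE; case: eqP => [eT|_]; last by rewrite mul0r mulr0.
by move: sTS; rewrite eT sub1set vS.
Qed.

Lemma homogeneous_lmul n v al : homogeneous n al -> homogeneous n.+1 (lmul v al).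
Proof.
move=> ha; rewrite -add1n; apply: homogeneousM ha => S nS; rewrite ffunE.
by have [eS|//] := eqVneq S [set v]; rewrite eS cards1 in nS.
Qed.

Lemma kmul1l al : kmul (delta set0 1) al = al.
Proof.
rewrite {1}[al]koszul_basis raddf_sum [RHS]koszul_basis /=; apply: eq_bigr => S _.
rewrite kmul_delta -setI_eq0 set0I eqxx set0U mul1r.
by rewrite /sg inversionsE big_set0 mul1r.
Qed.

(** When u_v has boundary 1, left multiplication by u_v is a contraction. *)
Lemma kdiff_lmul (y : V -> k) v al : y v = 1 ->
  kdiff y (lmul v al) = al - lmul v (kdiff y al).
Proof.
move=> yv; rewrite /lmul kdiffM kdiff_delta big_set1 setDv yv mulr1 mulr1.
rewrite /sg inversionsE big_set1 big_set0 kmul1l kbar_delta cards1 expr1 mulN1r.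
congr (_ + _).
have -> : delta [set v] (-1) = - delta [set v] (1 : k).
  by apply/ffunP => S; rewrite !ffunE; case: eqP; rewrite ?oppr0.
by rewrite -[- delta _ _]sub0r kmulBl kmul0l sub0r.
Qed.

End LeftMultiplication.

(** * Comparison of the Koszul algebras of a complex and its blow-up *)

Section Blowup.
Local Open Scope ring_scope.
Variables (V W : finType) (f : W -> option V) (s : V -> W).
Hypothesis fs : forall v, f (s v) = Some v.
Variables (K : scomplex V) (L : scomplex W).

(** The v whose block, the fibre of f over v, lies entirely in S. The hypothesis
[faceL] below says that L is the complex obtained from K by replacing each vertex
by its block in all minimal nonfaces. *)
Definition full_blocks (S : {set W}) : {set V} :=
  [set v | [forall w, (f w == Some v) ==> (w \in S)]].

Hypothesis faceL : forall S, (S \in faces L) = (full_blocks S \in faces K).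

Variable k : comNzRingType.
Local Notation A := (face_ring k K).
Local Notation B := (face_ring k L).
Local Notation xA := (face_ring_var k K).
Local Notation xB := (face_ring_var k L).
Local Notation expoV := {ffun V -> nat}.
Local Notation expoW := {ffun W -> nat}.
Implicit Types (c : expoW) (e : expoV) (S : {set W}) (T : {set V}) (al : koszul W k).

Lemma section_inj : injective s.
Proof. by move=> v v' e; apply: Some_inj; rewrite -!fs e. Qed.

Lemma full_blocksP S v :
  reflect (forall w, f w = Some v -> w \in S) (v \in full_blocks S).
Proof.
rewrite inE; apply: (iffP forallP) => [h w fw|h w].
  by have := h w; rewrite fw eqxx.
by apply/implyP => /eqP; apply: h.
Qed.

(** The image of the variable of v, and its quotient by the variable of s v. *)
Definition block_mon (v : V) : B := mon k L (fun w => f w == Some v).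
Definition block_rest (v : V) : B := mon k L (fun w => (f w == Some v) && (w != s v)).

Lemma block_mon_nonface T : T \notin faces K -> \prod_(v in T) block_mon v = 0.
Proof.
move=> nT; rewrite big_mkcond.
rewrite (eq_bigr (fun v => mon k L (fun w => (v \in T) && (f w == Some v)))); last first.
  by move=> v _; case: (v \in T) => //=; rewrite mon0.
rewrite mon_prod mon_nonface // faceL; apply: contra nT; apply: face_sub.
apply/subsetP => v vT; apply/full_blocksP => w fw.
by rewrite inE (bigD1 v) //= vT fw eqxx.
Qed.

Definition face_blowup : {rmorphism A -> B} := face_lift_hom (scal L) block_mon_nonface.

Lemma face_blowup_var v : face_blowup (xA v) = xB (s v) * block_rest v.
Proof.
rewrite face_lift_var var_mon monM; apply: eq_mon => w; rewrite inE.
by have [->|] := eqVneq w (s v); rewrite ?fs ?eqxx ?andbF ?andbT.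
Qed.

(** The degree in k[L] of the image of a monomial of degree e. *)
Definition pull e : expoW := [ffun w => if f w is Some v then e v else 0%N].

Lemma pullE e w v : f w = Some v -> pull e w = e v.
Proof. by rewrite ffunE => ->. Qed.

Lemma pull_section e v : pull e (s v) = e v.
Proof. exact: pullE (fs v). Qed.

Lemma sum_block (F : V -> nat) w :
  (\sum_v F v * (f w == Some v) = if f w is Some v then F v else 0)%N.
Proof.
case: (f w) => [v|]; last by rewrite big1 // => v _; rewrite muln0.
rewrite (bigD1 v) //= eqxx muln1 big1 ?addn0 // => u uv.
by rewrite (inj_eq Some_inj) eq_sym (negPf uv) muln0.
Qed.

Lemma face_blowup_mon (e : V -> nat) :
  face_blowup (mon k K e) = mon k L (fun w => if f w is Some v then e v else 0%N).
Proof.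
rewrite rmorph_prod; under eq_bigr do rewrite rmorphXn /= -/(face_blowup _) face_blowup_var.
transitivity (\prod_v mon k L (fun w => (f w == Some v) * e v)%N).
  apply: eq_bigr => v _; rewrite -face_blowup_var [face_blowup _]face_lift_var monX.
  by [].
rewrite mon_prod; apply: eq_mon => w; rewrite -(sum_block e).
by apply: eq_bigr => v _; rewrite mulnC.
Qed.

Lemma face_blowup_scal t : face_blowup (scal K t) = scal L t.
Proof. exact: face_lift_scal. Qed.

Lemma weight_mon T : weight block_rest T =
  mon k L (fun w => if f w is Some v then ((v \in T) && (w != s v) : nat) else 0%N).
Proof.
rewrite /weight big_mkcond.
rewrite (eq_bigr (fun v =>
  mon k L (fun w => ((v \in T) && (w != s v)) * (f w == Some v))%N)); last first.
  move=> v _; case: (v \in T) => /=; last by rewrite -(mon0 k L); apply: eq_mon.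
  by apply: eq_mon => w; rewrite mulnC mulnb.
by rewrite mon_prod; apply: eq_mon => w; rewrite (sum_block (fun v => (v \in T) && (w != s v))).
Qed.

Definition blowup_hom : dga_hom (koszul_dga xA) (koszul_dga xB) :=
  koszul_hom section_inj face_blowup_var.

(** The comparison morphism in the coordinates of one degree. *)
Definition spread (be : koszul V k) : koszul W k :=
  koszul_map s idfun (fun=> 1 : k) be.

Lemma weight1 T : weight (fun=> 1 : k) T = 1.
Proof. exact: big1. Qed.

Lemma spread_at be T : spread be (s @: T) = eps s k T * be T.
Proof. by rewrite /spread (koszul_map_at section_inj) weight1 mulr1. Qed.

Lemma imset_section_inS S : S \subset codom s -> exists T, S = s @: T.
Proof.
move=> /subsetP sS; exists (s @^-1: S); apply/setP => w; apply/idP/imsetP.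
  by move=> wS; have /codomP[v ew] := sS w wS; exists v; rewrite // inE -ew.
by case=> v; rewrite inE => sv ->.
Qed.

Lemma section_supp T e : (s @: T \subset supp (pull e)) = (T \subset supp e).
Proof.
apply/subsetP/subsetP => [h v vT|h _ /imsetP[v /h vT ->]].
  by have := h (s v) (imset_f _ vT); rewrite !inE pull_section.
by move: vT; rewrite !inE pull_section.
Qed.

(** In degree c = pull e, the element x^(e - 1_T) u_T goes to x^(c - 1_(s T)) u_(s T)
up to sign: the factors of [block_rest] restore the variables of the blocks of T
other than those of s T. *)
Lemma blowup_hom_mincl e be : blowup_hom (mincl K e be) = mincl L (pull e) (spread be).
Proof.
apply/ffunP => S; have [sS|nS] := boolP (S \subset codom s); last first.
  rewrite [RHS]ffunE [LHS]koszul_map_out // [spread _ _]koszul_map_out //.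
  by rewrite raddf0 mul0r if_same.
have [T ->] := imset_section_inS sS.
rewrite [LHS](koszul_map_at section_inj) [RHS]ffunE spread_at section_supp ffunE.
case: ifP => sT; last by rewrite raddf0 mul0r mulr0.
rewrite !rmorphM /= -/(face_blowup _) face_blowup_mon [face_blowup (scal _ _)]face_blowup_scal.
rewrite weight_mon -mulrA monM.
rewrite rmorph_sign mulrA; congr (_ * _); apply: eq_mon => w.
rewrite !ffunE; case fw: (f w) => [v|]; last by rewrite sub0n.
rewrite ffunE; have [->|nw] := eqVneq w (s v).
  by rewrite andbF addn0 (mem_imset _ _ section_inj).
rewrite andbT (_ : w \in s @: T = false) ?subn0; last first.
  by apply/imsetP => -[u _ ew]; move: fw nw; rewrite ew fs => -[->]; rewrite eqxx.
by case: (boolP (v \in T)) => [/(subsetP sT)|]; rewrite ?inE ?addn0 ?subn0 // => /subnK.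
Qed.

Lemma cell_section e T : cell K e T -> cell L (pull e) (s @: T).
Proof.
case/andP=> sT fT; rewrite /cell section_supp sT faceL; apply: face_sub fT.
apply/subsetP => v /full_blocksP/(_ (s v) (fs v)).
by rewrite !inE !ffunE fs (mem_imset _ _ section_inj).
Qed.

Lemma pull_inj : injective pull.
Proof. by move=> e e' h; apply/ffunP => v; rewrite -!pull_section h. Qed.

(** Distinct degrees have distinct images, and within a degree the coordinate of T
is found, up to sign, in position s @: T, which is a cell of L whenever T is one
of K. *)
Lemma blowup_hom_inj : injective blowup_hom.
Proof.
move=> b b' ebb; apply/eqP; rewrite -subr_eq0; apply/eqP.
have : blowup_hom (b - b') = 0 by rewrite dga_funB ebb subrr.
move: (b - b') => {ebb b'}b; have [l ul eb] := mpart_decomposition (K := K) b.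
rewrite {1}eb dga_fun_sum; under eq_bigr do rewrite blowup_hom_mincl.
move=> b0; apply: (@mpart_eq0 _ _ K) => e; apply/ffunP => T; rewrite [RHS]ffunE.
have [gT|nT] := boolP (cell K e T); last exact: mpart_noncell.
have [el|nel] := boolP (e \in l); last first.
  by rewrite {1}eb mpart_sum // (negPf nel).
have := congr1 (fun a : koszul W B => mpart (pull e) a (s @: T)) b0.
rewrite raddf_sum sum_ffunE raddf0 [X in _ = X]ffunE (bigD1_seq e) //= big1 => [|d nde].
  rewrite addr0 mpart_mincl eqxx cell_section // spread_at => /(congr1 ( *%R (eps s k T))).
  by rewrite mulr0 mulrA -expr2 sqrr_sign mul1r.
by rewrite mpart_mincl (inj_eq pull_inj) eq_sym (negPf nde).
Qed.

(** Removing w from S puts w in the support of c - 1_S. That is harmless if it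
completes no block: either w lies in no block, or some other u of its block is
missing from the support, or w was in the support before. *)
Lemma cell_remove c S w : w \in S -> cell L c S ->
  (forall v, f w = Some v -> exists u, [/\ f u = Some v, u != w &
     ((u \in S) < c u)%N -> (1 < c w)%N]) ->
  cell L c (S :\ w).
Proof.
move=> wS /andP[sS fS] hw; rewrite /cell (subset_trans (subD1set _ _) sS).
move: fS; rewrite !faceL; apply: face_sub; apply/subsetP => v /full_blocksP h.
apply/full_blocksP => u fu; have := h u fu; rewrite !inE !ffunE in_setD1.
have [euw _|//] := eqVneq u w; rewrite {u}euw in fu *.
have [u [fu' nuw lt1]] := hw v fu.
have := h u fu'; rewrite inE ffunE in_setD1 nuw /= subn_gt0 => /lt1.
by rewrite wS subn_gt0.
Qed.

(** The degrees in the image of [pull]. *)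
Definition constant c := [forall w, c w == if f w is Some v then c (s v) else 0%N].

Lemma constant_pull c : constant c -> c = pull [ffun v => c (s v)].
Proof.
move=> /forallP h; apply/ffunP => w; rewrite ffunE (eqP (h w)).
by case: (f w) => // v; rewrite ffunE.
Qed.

Lemma pull_constant e : constant (pull e).
Proof.
apply/forallP => w; rewrite {1}ffunE; case: (f w) => [v|] //.
by rewrite pull_section.
Qed.

(* a degree which is not constant has a vertex whose removal keeps cell sets *)
(** Such a vertex is one outside all blocks where c is nonzero, or one at which c
is larger than at another vertex of the same block. *)
Lemma nonconstant_vertex c : ~~ constant c -> exists w, (0 < c w)%N /\
  (forall S, w \in S -> cell L c S -> cell L c (S :\ w)).
Proof.
rewrite negb_forall => /existsP[w].
case fw: (f w) => [v|] nw; last first.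
  exists w; rewrite lt0n; split=> // S wS gS.
  by apply: cell_remove wS gS _ => v; rewrite fw.
have larger u u' : f u = Some v -> f u' = Some v -> (c u' < c u)%N ->
    exists w, (0 < c w)%N /\ (forall S, w \in S -> cell L c S -> cell L c (S :\ w)).
  move=> fu fu' lt; exists u; split=> [|S uS gS]; first exact: leq_ltn_trans lt.
  apply: cell_remove uS gS _ => v'; rewrite fu => -[<-]; exists u'; split=> //.
    by apply: contraTneq lt => ->; rewrite ltnn.
  by move=> lt'; apply: leq_trans lt; rewrite ltnS; apply: leq_ltn_trans lt'.
move: nw; case: ltngtP => // lt _; [exact: larger (fs v) fw lt|exact: larger fw (fs v) lt].
Qed.

(** The vertex w of [nonconstant_vertex] can be removed from cells, so that left
multiplication by u_w preserves the span of the sets that are not cells; hence it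
induces a contraction of the part of degree c. *)
Lemma contract_nonconstant n c al : ~~ constant c -> homogeneous n al ->
  (forall S, cell L c S -> kdiff (supp_ind k c) al S = 0) ->
  exists2 ze, homogeneous n.+1 ze & mincl L c (al + kdiff (supp_ind k c) ze) = 0.
Proof.
move=> /nonconstant_vertex[w [cw gw]] ha dal.
exists (- lmul w al).
  rewrite -sub0r; apply: homogeneousB; first exact: homogeneous0.
  exact: homogeneous_lmul.
apply: mincl_eq0 => S gS; rewrite raddfN /= kdiff_lmul ?/supp_ind ?cw //.
rewrite opprB addrC subrK lmulE; case: ifP => // wS.
by rewrite dal ?mulr0 //; apply: gw.
Qed.

(** The terms of a chain that contain w. *)
Definition with_vertex w al : koszul W k := [ffun S : {set W} => if w \in S then al S else 0].

Lemma kdiff_with_vertex (y : W -> k) w al S : w \in S ->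
  kdiff y (with_vertex w al) S = kdiff y al S.
Proof.
move=> wS; rewrite !ffunE; apply: eq_bigr => u _.
by rewrite ffunE in_setU1 wS orbT.
Qed.

Lemma constantP c w v : constant c -> f w = Some v -> c w = c (s v).
Proof. by move=> /forallP/(_ w)/eqP; case: (f w) => // u e [<-]. Qed.

(** A vertex w outside the image of s is eliminated by the homotopy
al |-> u_t (terms of al that contain w), where t is the chosen vertex of the block
of w. Its boundary has the same terms containing w as al, up to u_t times the
terms of the boundary of al that contain w, which vanish by hypothesis. Removing
t from a cell that contains w gives a cell again, since c takes the same value at
t and w; so the homotopy is defined on cells, and it does not reintroduce the
vertices eliminated before. *)
Lemma push_to_section n c al : constant c -> homogeneous n al ->
  (forall S, cell L c S -> ~~ (S \subset codom s) -> kdiff (supp_ind k c) al S = 0) ->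
  exists2 ze, homogeneous n.+1 ze &
    forall S, cell L c S -> ~~ (S \subset codom s) ->
      (al + kdiff (supp_ind k c) ze) S = 0.
Proof.
move=> cc ha dal; set d := kdiff (supp_ind k c).
suff push (ws : seq W) : all (fun w => w \notin codom s) ws ->
    exists2 ze, homogeneous n.+1 ze &
    forall S, cell L c S -> has (mem S) ws -> (al + d ze) S = 0.
  have [|ze hze zeP] := push (enum [pred w | w \notin codom s]).
    by apply/allP => w; rewrite mem_enum.
  exists ze => // S gS /subsetPn[w wS nw]; apply: zeP => //.
  by apply/hasP; exists w; rewrite ?mem_enum.
elim: ws => [_|w ws IH /= /andP[nw nws]].
  by exists 0 => //; apply: homogeneous0.
have [ze hze zeP] := IH nws.
(* w belongs to no cell if c w = 0, in particular if f w = None *)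
have [cw0|cw0] := posnP (c w).
  exists ze => // S gS /orP[wS|]; last exact: zeP.
  by case/andP: gS => /subsetP/(_ w wS); rewrite inE cw0.
have [v fw] : exists v, f w = Some v.
  by move: cw0; rewrite (eqP (forallP cc w)); case: (f w) => // v _; exists v.
have cwv := constantP cc fw; set t := s v in cwv.
have wt : w != t by apply: contraNneq nw => ->; apply: codom_f.
have gt S : t \in S -> w \in S -> cell L c S -> cell L c (S :\ t).
  move=> tS wS gS; apply: cell_remove tS gS _ => v'; rewrite fs => -[<-].
  by exists w; split; rewrite ?wS -?cwv.
pose al1 := al + d ze; pose ga := with_vertex w al1.
have hga : homogeneous n ga.
  move=> S nS; rewrite ffunE; case: ifP => // _.
  by rewrite /al1 ffunE (ha S nS) add0r; exact: (homogeneous_diff (supp_ind k c) hze).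
have dal1 : d al1 = d al by rewrite /al1 /d raddfD /= kdiffK addr0.
exists (ze - lmul t ga).
  by apply: homogeneousB => //; apply: homogeneous_lmul.
have yt : supp_ind k c t = 1 by rewrite /supp_ind -cwv cw0.
move=> S gS hS.
have -> : al + d (ze - lmul t ga) = al1 - d (lmul t ga).
  by rewrite /d kdiffB addrA.
have [wS|nwS] := boolP (w \in S).
  have e0 : (al1 - ga) S = 0.
    by rewrite [LHS]ffunE [(- ga) S]ffunE [ga S]ffunE wS subrr.
  rewrite /d kdiff_lmul // opprB addrCA addrC [LHS]ffunE e0 add0r.
  rewrite lmulE; case: ifP => // tS.
  rewrite kdiff_with_vertex ?inE ?wt // -/d dal1 dal ?mulr0 //; first exact: gt.
  by apply/subsetPn; exists w; rewrite ?inE ?wt.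
move: hS; rewrite (negPf nwS) /= => hS.
rewrite [LHS]ffunE (zeP S gS hS) add0r [LHS]ffunE; apply/eqP; rewrite oppr_eq0.
rewrite [d _ _]ffunE big1 // => u uS.
rewrite /supp_ind; case: (posnP (c u)) => [_|cu]; first by rewrite mulr0n mul0r mulr0.
have gT := cell_add gS cu; rewrite lmulE; case: ifP => [tT|]; last by rewrite !mulr0.
rewrite ffunE; case: ifP => [|]; last by rewrite !mulr0.
rewrite in_setD1 => /andP[_ wT]; rewrite zeP ?mulr0 //; first exact: gt.
case/hasP: hS => w' w'ws w'S; apply/hasP; exists w' => //=.
rewrite !inE; move: (w'S) => /= ->; rewrite orbT andbT.
by apply: contraNneq (allP nws w' w'ws) => ->; apply: codom_f.
Qed.

Lemma mincl_in_image n c al : constant c -> homogeneous n al ->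
  (forall S, cell L c S -> ~~ (S \subset codom s) -> al S = 0) ->
  exists2 b : koszul V A, homogeneous n b & mincl L c al = blowup_hom b.
Proof.
move=> cc ha al0.
pose be : koszul V k := [ffun T : {set V} => eps s k T * al (s @: T)].
exists (mincl K [ffun v => c (s v)] be).
  apply: homogeneous_mincl => T nT; rewrite ffunE ha ?mulr0 //.
  by rewrite (card_imset _ section_inj).
rewrite blowup_hom_mincl -constant_pull //; apply/eqP; rewrite -subr_eq0 -minclB.
apply/eqP/mincl_eq0 => S gS; rewrite [LHS]ffunE [(- spread be) S]ffunE.
have [sS|nS] := boolP (S \subset codom s); last first.
  by rewrite al0 // [spread _ _]koszul_map_out // subrr.
have [T eS] := imset_section_inS sS; rewrite eS spread_at ffunE.
by rewrite mulrA -expr2 sqrr_sign mul1r subrr.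
Qed.

Lemma mpart_blowup_hom c (b : koszul V A) : ~~ constant c -> mpart c (blowup_hom b) = 0.
Proof.
move=> nc; have [l ul eb] := mpart_decomposition (K := K) b.
rewrite eb dga_fun_sum; under eq_bigr do rewrite blowup_hom_mincl.
rewrite raddf_sum big1 //= => e _.
apply/ffunP => S; rewrite mpart_mincl [RHS]ffunE; case: eqP => // ec.
by rewrite ec pull_constant in nc.
Qed.

(** Each component of a is moved into the image of the comparison morphism by a
boundary, in constant degrees by [push_to_section], in the others to zero by
[contract_nonconstant]. Both apply since the boundary of a, being in the image,
has only cells inside the image of s, in constant degrees. The element b' so
obtained has boundary b by injectivity. *)
Lemma blowup_hom_weak_lifting : weak_lifting blowup_hom.
Proof.
move=> n b a hb db ha eba.
have part_d c S : cell L c S ->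
    kdiff (supp_ind k c) (mpart c a) S = mpart c (blowup_hom b) S.
  by move=> gS; rewrite eba -mpart_diff.
have solve c : exists p : koszul V A * koszul W k, [/\ homogeneous n.+1 p.1,
    homogeneous n.+2 p.2 &
    blowup_hom p.1 = mincl L c (mpart c a + kdiff (supp_ind k c) p.2)].
  have hpa : homogeneous n.+1 (mpart c a) by apply: homogeneous_mpart.
  have [cc|nc] := boolP (constant c).
    have [|ze hze zeP] := push_to_section cc hpa.
      move=> S gS nS; rewrite part_d // ffunE [blowup_hom b S]koszul_map_out //.
      by rewrite raddf0 if_same.
    have hsum : homogeneous n.+1 (mpart c a + kdiff (supp_ind k c) ze).
      rewrite -[kdiff _ _]opprK; apply: homogeneousB => //.
      rewrite -sub0r; apply: homogeneousB; first exact: homogeneous0.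
      exact: homogeneous_diff.
    have [b' hb' eb'] := mincl_in_image cc hsum zeP.
    by exists (b', ze).
  have [|ze hze zeP] := contract_nonconstant nc hpa.
    by move=> S gS; rewrite part_d // mpart_blowup_hom // ffunE.
  by exists (0, ze); split=> //=; [apply: homogeneous0|rewrite zeP [LHS]raddf0].
have [p pP] := choice solve.
have [l _ ea] := mpart_decomposition (K := L) a.
pose b' : koszul_dga xA := \sum_(c <- l) (p c).1.
pose z : koszul_dga xB := \sum_(c <- l) mincl L c (p c).2.
have eb' : blowup_hom b' = a + ddiff z.
  rewrite dga_fun_sum [ddiff z]raddf_sum {1}ea -big_split; apply: eq_bigr => c _.
  by have [_ _ ->] := pP c; rewrite raddfD /= mincl_diff.
exists b', z; split=> //.
- by apply: ddeg_sum => c _; have [] := pP c.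
- by apply: ddeg_sum => c _; apply: homogeneous_mincl; have [] := pP c.
- apply: blowup_hom_inj; rewrite dga_fun_diff eb' raddfD /= kdiffK addr0.
  exact: esym eba.
Qed.

Theorem golod_over_blowup : golod_over k K <-> golod_over k L.
Proof.
have bd := @koszul_graded_boundary _ _ xB.
have tm := trivial_products_transfer bd blowup_hom_weak_lifting.
have th := trivial_higher_transfer bd blowup_hom_weak_lifting.
by split=> -[/trivial_multiplicationE/tm h1 /trivial_masseyE/th h2].
Qed.

End Blowup.

Lemma golod_blowup (V W : finType) (f : W -> option V) (s : V -> W)
    (K : scomplex V) (L : scomplex W) :
  (forall v, f (s v) = Some v) ->
  (forall S, (S \in faces L) = (full_blocks f S \in faces K)) ->
  golod K <-> golod L.
Proof.
move=> fs faceL; split=> -[gF gZ]; split.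
- by move=> k; apply/(golod_over_blowup fs faceL).
- by apply/(golod_over_blowup fs faceL).
- by move=> k; apply/(golod_over_blowup fs faceL).
- by apply/(golod_over_blowup fs faceL).
Qed.

Lemma vertex_deletion_faceE (V : finType) (K : scomplex V) (v : V)
    (S : {set {u : V | u \in [set~ v]}}) :
  (S \in faces (vertex_deletion K v)) = (val @: S \in faces K).
Proof. by rewrite inE. Qed.

(** * Multiwedges and vertex deletions *)

Section Multiwedge.
Variables (V : finType) (K : scomplex V) (J : V -> nat).
Hypothesis J_gt0 : forall i, 0 < J i.
Local Notation VJ := {i : V & 'I_(J i)}.

Definition first_copy i : VJ := Tagged (fun i => 'I_(J i)) (Ordinal (J_gt0 i)).

Lemma blowup_full (M : {set V}) (S : {set VJ}) :
  (blowup J M \subset S) = (M \subset full_blocks (fun x : VJ => Some (tag x)) S).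
Proof.
apply/subsetP/subsetP => [h i iM|h x].
  by apply/full_blocksP => x [ex]; apply: h; rewrite inE ex.
by rewrite inE => /h/full_blocksP; apply.
Qed.

Lemma multiwedge_faceE (S : {set VJ}) :
  (S \in faces (multiwedge K J_gt0)) =
  (full_blocks (fun x : VJ => Some (tag x)) S \in faces K).
Proof.
rewrite inE; apply/forall_inP/idP => [h|fS M Mm].
  apply/negPn/negP => nf; have [M Mm sM] := minset_exists (P := [pred S | S \notin faces K]) nf.
  by have := h M; rewrite inE Mm blowup_full sM => /(_ isT).
rewrite blowup_full; apply: contra (minimal_nonface_notin Mm) => sM.
exact: face_sub sM fS.
Qed.

Lemma golod_multiwedge : golod K <-> golod (multiwedge K J_gt0).
Proof.
apply: (golod_blowup (s := first_copy) (f := fun x => Some (tag x))) => //.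
exact: multiwedge_faceE.
Qed.

(** The copies of tag x other than x are in no minimal nonface of the deletion, and
they are the vertices where the partial map to V minus tag x is undefined. *)
Lemma golod_multiwedge_deletion (x : VJ) :
  golod (vertex_deletion K (tag x)) <-> golod (vertex_deletion (multiwedge K J_gt0) x).
Proof.
have first_in (i : {i | i \in [set~ tag x]}) : first_copy (val i) \in [set~ x].
  rewrite !inE; have := valP i; rewrite !inE; apply: contra => /eqP/(congr1 tag)/= e.
  exact/eqP.
apply: (golod_blowup (f := fun y => insub (tag (val y)))
  (s := fun i => Sub (first_copy (val i)) (first_in i))) => [i|S].
  by rewrite SubK /= valK.
rewrite !vertex_deletion_faceE multiwedge_faceE.
pose f' (y : {y | y \in [set~ x]}) : option {i | i \in [set~ tag x]} := insub (tag (val y)).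
suff <- : val @: full_blocks f' S = full_blocks (fun y : VJ => Some (tag y)) (val @: S).
  by [].
apply/setP => i; apply/imsetP/full_blocksP => [[i' /full_blocksP h ->] y [ty]|h].
  have yx : y \in [set~ x].
    rewrite !inE; apply/eqP => exy; have := valP i'.
    by rewrite [\val i'](esym ty) exy !inE eqxx.
  apply/imsetP; exists (Sub y yx); last by rewrite SubK.
  by apply: h; rewrite /f' SubK ty valK.
have ix : i \in [set~ tag x].
  rewrite !inE; apply/eqP => e.
  have /imsetP[y _ ey] := h x (congr1 Some (esym e)).
  have : val y \in [set~ x] := valP y.
  by rewrite -ey !inE eqxx.
exists (Sub i ix); last by rewrite SubK.
apply/full_blocksP => y; rewrite /f'; case: insubP => // j _ ej [ji].
have /h : Some (tag (val y)) = Some i by rewrite -ej ji SubK.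
by rewrite (mem_imset _ _ val_inj).
Qed.

Lemma minimally_non_golod_multiwedge :
  minimally_non_golod K <-> minimally_non_golod (multiwedge K J_gt0).
Proof.
split=> -[nK gK]; split=> [/golod_multiwedge//|v].
  by apply/golod_multiwedge_deletion.
exact/(golod_multiwedge_deletion (first_copy v)).
Qed.

End Multiwedge.

Theorem proposition3p3 (m : nat) (K : scomplex 'I_m) (J : 'I_m -> nat)
    (J_gt0 : forall i : 'I_m, (0 < J i)%N) :
  (golod K <-> golod (multiwedge K J_gt0)) /\
  (minimally_non_golod K <-> minimally_non_golod (multiwedge K J_gt0)).
Proof. by split; [apply: golod_multiwedge|apply: minimally_non_golod_multiwedge]. Qed.
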